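(* Let $G=\langle a,x,y,z\rangle$ be a sandwich group with sandwich generating set $\{a,x,y,z\}$, where $a,x,y,z$ are (four distinct) involutions, and suppose that the commutativity graph of $G$ with respect to these generators has exactly the two edges $a - x$ and $a - y$. If $[[z,x],[z,a]]=1$ and $[[z,y],[z,a]]=1$, then $G$ is nilpotent.
   Context: Notation: $g^h=h^{-1}gh$ and $[g,h]=g^{-1}h^{-1}gh$. A subset $X$ of a group is a sandwich set if $\langle u,v^{g}\rangle$ is nilpotent of class at most $2$ for all $u,v\in X$ (including $u=v$) and all $g\in\langle X\rangle$. A group $G$ is a sandwich group if it is generated by a sandwich set $X$. The commutativity graph of a sandwich group generated by a finite sandwich set $X$ is the undirected graph with vertex set $X$ in which two distinct vertices are joined by an edge if and only if they commute in $G$. *)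

(* Defs.v *)
From HB Require Import structures.
From mathcomp Require Import ssreflect ssrfun ssrbool eqtype ssrnat seq choice.
From mathcomp Require Import monoid.
From mathcomp Require Import boolp classical_sets.

Set Implicit Arguments.
Unset Strict Implicit.
Unset Printing Implicit Defensive.

(* [groupType] is the type of possibly infinite groups; its [x ^ y] is
   y^-1 * (x * y) and its [~ x, y] is x^-1 * x ^ y. *)
Local Open Scope classical_set_scope.
Local Open Scope group_scope.

Definition is_subgroup (G : groupType) (H : set G) : Prop :=
  H 1 /\ (forall g h, H g -> H h -> H (g / h)).

Definition generated (G : groupType) (X : set G) : set G :=
  smallest (@is_subgroup G) X.

Definition commutator_subgroup (G : groupType) (H K : set G) : set G :=
  generated [set [~ h, k] | h in H & k in K].

(* Indexed from 0: [lower_central H n] is the (n+1)-st term gamma_(n+1)(H) of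
   the lower central series, with gamma_1(H) = H. *)
Fixpoint lower_central (G : groupType) (H : set G) (n : nat) : set G :=
  if n is m.+1 then commutator_subgroup (lower_central H m) H else H.

Definition nilpotent_class_le (G : groupType) (c : nat) (H : set G) : Prop :=
  lower_central H c = [set 1].

Definition is_nilpotent (G : groupType) (H : set G) : Prop :=
  exists c : nat, nilpotent_class_le c H.

Definition sandwich_set (G : groupType) (X : set G) : Prop :=
  forall u v g, X u -> X v -> generated X g ->
    nilpotent_class_le 2 (generated [set u; v ^ g]).

Definition sandwich_generating_set (G : groupType) (X : set G) : Prop :=
  sandwich_set X /\ generated X = [set: G].

Definition involution (G : groupType) (g : G) : Prop := g <> 1 /\ g ^+ 2 = 1.

(* An undirected edge is encoded as the unordered pair of its endpoints. *)
Definition commutativity_edges (G : groupType) (X : set G) : set (set G) :=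
  [set e | exists u v, [/\ X u, X v, u <> v, commute u v & e = [set u; v]]].

(* Main.v *)
Require Import Defs.
From HB Require Import structures.
From mathcomp Require Import ssreflect ssrfun ssrbool eqtype ssrnat seq choice.
From mathcomp Require Import fintype finset div prime fingroup cyclic pgroup nilpotent sylow.
From mathcomp Require Import generic_quotient.
From mathcomp Require Import monoid.
From mathcomp Require Import boolp classical_sets functions cardinality.
Require Import Defs.

(** G is shown to be finite and to consist of elements of 2-power order; finite
    2-groups are nilpotent.

    For involutions, <u, v> has class at most 2 exactly when u commutes with
    u ^ v. So the sandwich condition says that each generator u commutes with
    u ^ (v ^ g), for every generator v and every g. Write r = x y. Then r ^ 4 = 1,
    so <x, y> is a quotient of the dihedral group of order 8, and z has at most the eight
    conjugates Z i = z ^ (r ^ i) and W i = z ^ (y r ^ i) under it. Each Z i commutes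
    with each W j [commuteZW], and the class conditions for x, y and their conjugates
    show that K, the group generated by all Z and W, has central
    commutators [commute_squareZ], hence is a finite 2-group.

    As a commutes with x and y, the sandwich condition for a and a reflection s
    says that a ^ h commutes with a ^ (h ^ s) for every h [commute_a_conj]. Let
    c = [z, a], and let C i and D i be its conjugates under the same elements as
    Z i and W i. The two commutator hypotheses say that c commutes with z ^ x and
    z ^ y. With h = z one gets that the C commute with the D, and each product h
    of a Z and a W gives one more relation. From these relations one finds
    central involutions one after the other: nu = [C 0, C 1], then elements theta,
    delta and omega built from P n = [C n, W (n + 1)] and Q n = [C n, W (n + 2)].
    An extension of a finite 2-group by a finite 2-group is a finite 2-group and
    the relations pass to quotients, so each of them may be assumed trivial. Once
    this is done, the P and Q generate a finite abelian normal subgroup, which may be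
    assumed trivial too.

    What is left is the case in which each C commutes with each W [fin2_no_cross].
    There a a ^ k commutes with all W whenever k is a product of Z, and the relations
    between a ^ k and a ^ (k ^ s) make its square central. Therefore the conjugates
    of a under K have central commutators and generate a finite 2-group, which is
    normalised by K; together with the group <x, y> these make up G.

    Identities between words are checked by the tactic [coxeter], which cancels
    letters in words in involutions, some of which commute. *)

Set Implicit Arguments.
Unset Strict Implicit.
Unset Printing Implicit Defensive.

Local Open Scope classical_set_scope.
Local Open Scope group_scope.

(** * Finite 2-groups are nilpotent *)

Section FiniteCopy.
Variables (G : groupType) (s : seq G).
Hypothesis sP : forall g, g \in s.
(** G again, as a finite type: the list that exhausts G is part of the type, so that
    the finite group structure can be attached to it. *)
Definition finite_copy : Type := let _ := sP in G.
HB.instance Definition _ := Group.on finite_copy.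
Definition copy_pickle (g : finite_copy) : nat := index (g : G) s.
Definition copy_unpickle (n : nat) : option finite_copy :=
  if n < size s then Some (nth 1 s n : finite_copy) else None.
Lemma copy_pickleK : pcancel copy_pickle copy_unpickle.
Proof. by move=> g; rewrite /copy_unpickle index_mem sP nth_index. Qed.
HB.instance Definition _ := PCanIsCountable copy_pickleK.
Lemma copy_enumP : @Finite.axiom finite_copy (undup (s : seq finite_copy)).
Proof. by move=> g; rewrite count_uniq_mem ?undup_uniq // mem_undup sP. Qed.
HB.instance Definition _ := isFinite.Build finite_copy copy_enumP.
End FiniteCopy.

Section Generated.
Variable G : groupType.
Implicit Types (X H N : set G) (g h : G).
Local Notation generated := (@Defs.generated G).

Lemma sub1 H : is_subgroup H -> H 1. Proof. by case. Qed.
Lemma subV H g : is_subgroup H -> H g -> H g^-1.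
Proof. by move=> [H1 Hd] Hg; rewrite -[g^-1]mul1g; apply: Hd. Qed.
Lemma subM H g h : is_subgroup H -> H g -> H h -> H (g * h).
Proof. by move=> sH Hg Hh; rewrite -[h]invgK; apply: (sH.2) => //; apply: subV. Qed.
Lemma generated_subgroup X : is_subgroup (generated X).
Proof.
split=> [H [sH _]|g h Xg Xh H sXH]; first exact: sub1.
by case: (sXH) => sH _; apply: sH.2; [apply: Xg|apply: Xh].
Qed.
Lemma mem_generated X : X `<=` generated X.
Proof. by move=> g Xg H [_]; apply. Qed.
Lemma generated_sub X H : is_subgroup H -> X `<=` H -> generated X `<=` H.
Proof. by move=> sH XH g; apply. Qed.

Lemma subgroupJ H g : is_subgroup H -> is_subgroup [set h | H (h ^ g)].
Proof.
move=> sH; split=> [|h k /= Hh Hk]; first by rewrite /= conj1g; apply: sub1.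
by rewrite conjMg conjVg; apply: sH.2.
Qed.
Lemma centralizer_subgroup g : is_subgroup [set h | commute h g].
Proof.
split=> [|h k /= hg kg]; first by apply/commute_sym/commute1.
by apply/commute_sym/commuteM; [apply: commute_sym|apply/commuteV/commute_sym].
Qed.

(** By Cauchy's theorem these are the finite 2-groups; stated through orders of
    elements, the property passes to products and extensions without counting. *)
Definition fin2 H := finite_set H /\ forall h, H h -> exists n, h ^+ (2 ^ n) = 1.
End Generated.

(** Cauchy's theorem makes G a finite 2-group. Its lower central series, formed with
    arbitrary subgroups, stays below the series of finite group theory, which reaches
    1. *)
Lemma fin2_nilpotent (G : groupType) : fin2 [set: G] -> is_nilpotent [set: G].
Proof.
case=> /finite_seqP [s sE] tors.
have sP g : g \in s by have : [set: G] g := I; rewrite sE.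
pose F := finite_copy sP.
have pF : 2.-group [set: F]%G.
  apply/pgroupP => p p_pr /(Cauchy p_pr) [g _ gp].
  have [n gn] := tors (g : G) I.
  have : #[g] %| 2 ^ n by rewrite order_dvdn; apply/eqP; exact: gn.
  by rewrite gp Euclid_dvdX // => /andP [p2 _]; rewrite inE/= -(dvdn_prime2 p_pr).
have /lcnP [c Lc] := pgroup_nil pF.
exists c.
have LsubP n : is_subgroup (lower_central [set: G] n).
  case: n => [|n]; last exact: generated_subgroup.
  by split.
have sub n : lower_central [set: G] n `<=` [set g | (g : F) \in 'L_n.+1([set: F]%G)].
  elim: n => [|n IH] g; first by rewrite /= lcn1 inE.
  apply: generated_sub; first by split=> [|u v /= *]; [rewrite /= group1|rewrite groupM ?groupV].
  move=> _ [h Lh [k _ <-]] /=; rewrite lcnSn mem_commg ?inE //.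
  exact: IH.
rewrite /nilpotent_class_le; apply/seteqP; split=> g.
  by move/sub; rewrite /= Lc inE => /eqP.
by move=> ->; apply: sub1.
Qed.

(** * Products and towers of finite 2-groups *)

Section Fin2.
Variable G : groupType.
Implicit Types (X H N M : set G) (g h : G).

Definition normalises H N := forall h n, H h -> N n -> N (n ^ h).

Lemma subgroup_mulset N H : is_subgroup N -> is_subgroup H -> normalises H N ->
  is_subgroup [set n * h | n in N & h in H].
Proof.
move=> sN sH nHN; split=> [|_ _ [n Nn [h Hh <-]] [m Nm [k Hk <-]]].
  by exists 1; [exact: sub1|exists 1; [exact: sub1|rewrite mulg1]].
exists (n * (m^-1 ^ (h * k^-1)^-1)).
  apply: subM => //; apply: nHN; last exact: subV.
  by apply: subV => //; apply: sH.2.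
exists (h * k^-1); first exact: sH.2.
by rewrite /conjg !invgM !invgK !mulgA mulgVK mulgK.
Qed.

(** Modulo N the powers of n * h are those of h. *)
Lemma fin2_mulset N H : is_subgroup N -> is_subgroup H -> normalises H N ->
  fin2 N -> fin2 H -> fin2 [set n * h | n in N & h in H].
Proof.
move=> sN sH nHN [fN tN] [fH tH]; split.
  have -> : [set n * h | n in N & h in H] = (fun p => p.1 * p.2) @` (N `*` H).
    apply/seteqP; split=> [_ [n Nn [h Hh <-]]|_ [[n h] [/= Nn Hh] <-]].
      by exists (n, h).
    by exists n => //; exists h.
  exact/finite_image/finite_setX.
move=> _ [n Nn [h Hh <-]]; have [i hi] := tH _ Hh.
have pow m : exists2 u, N u & (n * h) ^+ m = u * h ^+ m.
  elim: m => [|m [u Nu IH]]; first by exists 1; [exact: sub1|rewrite mulg1].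
  exists (n * u ^ h^-1); last by rewrite expgS IH expgS /conjg invgK !mulgA !mulgVK.
  by apply: subM => //; apply: nHN => //; apply: subV.
have [u Nu uE] := pow (2 ^ i)%N; have [j uj] := tN _ Nu.
by exists (i + j)%N; rewrite expnD expgnA uE hi mulg1.
Qed.

Lemma fin2_sub N M : N `<=` M -> fin2 M -> fin2 N.
Proof. by move=> NM [fM tM]; split=> [|h /NM /tM //]; apply: sub_finite_set fM. Qed.

Lemma fin2_generated0 : fin2 (Defs.generated (set0 : set G)).
Proof.
apply: (@fin2_sub _ [set 1]).
  by apply: generated_sub => //; split=> // g h -> ->; rewrite mulgV.
by split=> [|h ->]; [exact: finite_set1|exists 0].
Qed.

Lemma subgroup_involution g : g * g = 1 -> is_subgroup [set 1; g].
Proof.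
move=> g2; split=> [|h k]; first by left.
have gV : g^-1 = g by rewrite -[RHS](mulgK g) g2 mul1g.
case=> -> [] ->; rewrite ?invg1 ?mulg1 ?mul1g ?gV ?g2; by [left|right].
Qed.

Lemma fin2_involution g : g * g = 1 -> fin2 [set 1; g].
Proof.
move=> g2; split=> [|h [] ->]; [|by exists 0|by exists 1%N].
by rewrite finite_setU; split; apply: finite_set1.
Qed.

(** A certificate that the members of the list generate a finite 2-group: the list is
    read from its end, and each member at most doubles the group. *)
Fixpoint involution_tower (s : seq G) : Prop :=
  if s is g :: s' then
    [/\ g * g = 1,
      (forall h, h \in s' -> Defs.generated [set` s'] (h ^ g)) &
      involution_tower s']
  else True.

Lemma fin2_tower s : involution_tower s -> fin2 (Defs.generated [set` s]).
Proof.
elim: s => [_|g s IH /= [g2 gs /IH fs]]; first by rewrite set_nil; exact: fin2_generated0.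
have sN := generated_subgroup [set` s]; have sH := subgroup_involution g2.
have nHN : normalises [set 1; g] (Defs.generated [set` s]).
  move=> h n [] -> Nn; first by rewrite conjg1.
  exact: (generated_sub (subgroupJ g sN) gs Nn).
apply: fin2_sub (fin2_mulset sN sH nHN fs (fin2_involution g2)).
apply: generated_sub; first exact: subgroup_mulset.
move=> h /=; rewrite inE => /orP [/eqP ->|hs].
  by exists 1; [exact: sub1|exists g; [right|rewrite mul1g]].
by exists h; [exact: mem_generated|exists 1; [left|rewrite mulg1]].
Qed.
End Fin2.

(** * Quotient groups *)

Section Quotient.
Local Open Scope quotient_scope.
Variables (G : groupType) (N : set G).
Hypotheses (sN : is_subgroup N) (nN : forall g n, N n -> N (n ^ g)).

Let rel_coset : rel G := fun g h => `[< N (g / h) >].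
Let rel_coset_equiv : equiv_class_of rel_coset.
Proof.
split=> [g|g h|h g k]; first by apply/asboolP; rewrite mulgV; apply: sub1.
  by apply/asboolP/asboolP => /(subV sN); rewrite invgF.
move=> /asboolP gh /asboolP hk; apply/asboolP.
by rewrite -(divgKA h); apply: subM.
Qed.
Canonical rel_coset_canonical := EquivRelPack rel_coset_equiv.

Definition quotient_group := {eq_quot rel_coset}.
HB.instance Definition _ := Choice.on quotient_group.
Local Notation pi := (\pi_quotient_group : G -> quotient_group).

Let piP g h : pi g = pi h <-> N (g / h).
Proof. by split=> [/eqmodP/asboolP|gh]; [|apply/eqmodP/asboolP]. Qed.

Let mulQ (u v : quotient_group) := pi (repr u * repr v).
Let invQ (u : quotient_group) := pi (repr u)^-1.
Let Nrepr g : N (repr (pi g) / g). Proof. by apply/piP; rewrite reprK. Qed.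

Let mulE g h : mulQ (pi g) (pi h) = pi (g * h).
Proof.
apply/piP; set u := repr _; set v := repr _.
have -> : u * v / (g * h) = (u / g) * (v / h) ^ g^-1.
  by rewrite /conjg invgM invgK !mulgA mulgVK.
by apply: subM => //; [apply: Nrepr|apply/nN/Nrepr].
Qed.
Let invE g : invQ (pi g) = pi g^-1.
Proof.
apply/piP; rewrite invgK.
have -> : (repr (pi g))^-1 * g = ((repr (pi g) / g)^-1) ^ g.
  by rewrite /conjg invgF !mulgA mulVg mul1g.
by apply/nN/(subV sN)/Nrepr.
Qed.

Let pi_surj u : exists g, pi g = u. Proof. by exists (repr u); rewrite reprK. Qed.

Let mulQA : associative mulQ.
Proof.
move=> u v w; have [[g <-] [[h <-] [k <-]]] := (pi_surj u, (pi_surj v, pi_surj w)).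
by rewrite !mulE mulgA.
Qed.
Let mul1Q : left_id (pi 1) mulQ.
Proof. by move=> u; have [g <-] := pi_surj u; rewrite mulE mul1g. Qed.
Let mulVQ : left_inverse (pi 1) invQ mulQ.
Proof. by move=> u; have [g <-] := pi_surj u; rewrite invE mulE mulVg. Qed.
Let invQK : involutive invQ.
Proof. by move=> u; have [g <-] := pi_surj u; rewrite !invE invgK. Qed.
Let invQM : {morph invQ : u v / mulQ u v >-> mulQ v u}.
Proof.
move=> u v; have [[g <-] [h <-]] := (pi_surj u, pi_surj v).
by rewrite mulE !invE mulE invgM.
Qed.
HB.instance Definition _ := isStarMonoid.Build quotient_group mulQA mul1Q invQK invQM.
HB.instance Definition _ := StarMonoid_isGroup.Build quotient_group mulVQ.

(** The only way in which the group of cosets is used. *)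
Lemma quotient_exists : exists (Q : groupType) (f : G -> Q),
  [/\ {morph f : g h / g * h}, forall u, exists g, f g = u
    & forall g, f g = 1 <-> N g].
Proof.
exists (quotient_group : groupType), pi; split=> [g h|u|g]; first by rewrite -mulE.
  exact: pi_surj.
by rewrite -[g in N g]divg1; apply: piP.
Qed.
End Quotient.

(** * Words in involutions *)

Section Words.
Variable G : groupType.
Implicit Types g h k u v w : G.

Lemma involV u : u * u = 1 -> u^-1 = u.
Proof. by move=> u2; rewrite -[RHS](mulgK u) u2 mul1g. Qed.
Lemma involK u : u * u = 1 -> forall w, w * u * u = w.
Proof. by move=> u2 w; rewrite -mulgA u2 mulg1. Qed.
Lemma involKl u : u * u = 1 -> forall w, u * (u * w) = w.
Proof. by move=> u2 w; rewrite mulgA u2 mul1g. Qed.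
Lemma conj_invol u v : v * v = 1 -> u ^ v = v * u * v.
Proof. by move=> v2; rewrite /conjg involV // mulgA. Qed.
Lemma involJ u g : u * u = 1 -> u ^ g * u ^ g = 1.
Proof. by move=> u2; rewrite -conjMg u2 conj1g. Qed.

Lemma conj_commute u v : commute u v -> u ^ v = u.
Proof. by move=> uv; rewrite /conjg uv mulKg. Qed.
Lemma commuteE u v : u ^ v = u -> commute u v.
Proof. by move=> uv; rewrite /commute conjgC uv. Qed.
Lemma commuteJ g u v : commute u v -> commute (u ^ g) (v ^ g).
Proof. by move=> uv; rewrite /commute -!conjMg uv. Qed.
Lemma commuteJK g u v : commute (u ^ g) (v ^ g) -> commute u v.
Proof. by move/(commuteJ g^-1); rewrite !conjgK. Qed.
Lemma commuteMl u v w : commute u w -> commute v w -> commute (u * v) w.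
Proof. by move=> uw vw; apply/commute_sym/commuteM; apply: commute_sym. Qed.
Lemma commute_conj u v g : commute u v -> commute u g -> commute u (v ^ g).
Proof. by move=> uv ug; rewrite -[u](conj_commute ug); apply: commuteJ. Qed.
Lemma commute_conjl u v g : commute u v -> commute v g -> commute (u ^ g) v.
Proof. by move=> uv vg; apply/commute_sym/commute_conj => //; apply: commute_sym. Qed.
Lemma commuteA u v w : commute u v -> w * u * v = w * v * u.
Proof. by move=> uv; rewrite -!mulgA uv. Qed.
Lemma commuteAl u v w : commute u v -> u * (v * w) = v * (u * w).
Proof. by move=> uv; rewrite !mulgA uv. Qed.
Lemma commuteMK u v w : commute u (v * w) -> commute u v -> commute u w.
Proof.
move=> uvw uv; rewrite -[w](mulKg v); apply: commuteM => //; exact: commuteV.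
Qed.
Lemma commuteMKl u v w : commute u (v * w) -> commute u w -> commute u v.
Proof.
move=> uvw uw; rewrite -[v](mulgK w); apply: commuteM => //; exact: commuteV.
Qed.

End Words.

Section RightAngledCoxeter.
Variable G : groupType.

Inductive gexpr :=
  | GVar of nat | GOne | GMul of gexpr & gexpr | GInv of gexpr | GConj of gexpr & gexpr.

Fixpoint gexpr_val (e : seq G) (t : gexpr) : G :=
  match t with
  | GVar i => nth 1 e i
  | GOne => 1
  | GMul t u => gexpr_val e t * gexpr_val e u
  | GInv t => (gexpr_val e t)^-1
  | GConj t u => gexpr_val e t ^ gexpr_val e u
  end.

Fixpoint gexpr_word (t : gexpr) : seq nat :=
  match t with
  | GVar i => [:: i]
  | GOne => [::]
  | GMul t u => gexpr_word t ++ gexpr_word u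
  | GInv t => rev (gexpr_word t)
  | GConj t u => rev (gexpr_word u) ++ gexpr_word t ++ gexpr_word u
  end.

Definition word_val (e : seq G) (w : seq nat) : G := foldr (fun i g => nth 1 e i * g) 1 w.

Fixpoint involutions (e : seq G) : Prop :=
  if e is u :: e' then u * u = 1 /\ involutions e' else True.
Fixpoint commuting (e : seq G) (ps : seq (nat * nat)) : Prop :=
  if ps is p :: ps' then commute (nth 1 e p.1) (nth 1 e p.2) /\ commuting e ps' else True.

Section Reduction.
Variable ps : seq (nat * nat).

Definition related i j := has (fun p => (p == (i, j)) || (p == (j, i))) ps.

Fixpoint pull i (w : seq nat) : option (seq nat) :=
  if w is j :: w' then
    if j == i then Some w' else if related i j then omap (cons j) (pull i w') else None
  else None.

Fixpoint reduce (w : seq nat) : seq nat :=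
  if w is i :: w' then
    let v := reduce w' in if pull i v is Some u then u else i :: v
  else [::].

Variable e : seq G.
Hypotheses (e2 : involutions e) (eps : commuting e ps).

Lemma nth_invol i : nth 1 e i * nth 1 e i = 1.
Proof.
elim: e e2 i => [_ i|u e' IH [u2 /IH e'2] [|i]] //=; by rewrite nth_nil mulg1.
Qed.

Lemma related_commute i j : related i j -> commute (nth 1 e i) (nth 1 e j).
Proof.
rewrite /related; elim: ps eps => [|p ps' IH] //= [cp /IH {}IH].
by case/orP => [/orP [] /eqP pE|/IH //]; rewrite pE in cp => //; apply: commute_sym.
Qed.

Lemma pull_val i w v : pull i w = Some v -> word_val e w = nth 1 e i * word_val e v.
Proof.
elim: w v => [|j w IH] v //=; case: eqP => [-> [->] //|_].
case: ifP => // /related_commute ij; case: pull IH => // u /(_ _ erefl) IH [<-] /=.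
by rewrite IH !mulgA ij.
Qed.

Lemma reduce_val w : word_val e (reduce w) = word_val e w.
Proof.
elim: w => [|i w IH] //=; case E: pull => [v|] /=; last by rewrite IH.
by rewrite -IH (pull_val E) mulgA nth_invol mul1g.
Qed.

Lemma word_val_cat w v : word_val e (w ++ v) = word_val e w * word_val e v.
Proof. by elim: w => [|i w IH] /=; rewrite ?mul1g // IH mulgA. Qed.

Lemma word_val_rev w : word_val e (rev w) = (word_val e w)^-1.
Proof.
elim: w => [|i w IH]; first by rewrite invg1.
by rewrite rev_cons -cats1 word_val_cat IH /= mulg1 invgM (involV (nth_invol i)).
Qed.

Lemma gexpr_wordP t : gexpr_val e t = word_val e (gexpr_word t).
Proof.
elim: t => [i||t IHt u IHu|t IHt|t IHt u IHu] //=; first by rewrite mulg1.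
- by rewrite word_val_cat IHt IHu.
- by rewrite word_val_rev IHt.
- by rewrite !word_val_cat word_val_rev /conjg IHt IHu.
Qed.

(** Deleting two equal letters that can be brought together does not change the value
    of a word. In the group in which the given commutations are the only relations
    between the involutions, words of value 1 reduce to the empty word, so the test is
    then decisive. *)
Lemma reduce_eq t u : reduce (gexpr_word t ++ rev (gexpr_word u)) = [::] ->
  gexpr_val e t = gexpr_val e u.
Proof.
move=> r1; apply/eqP; rewrite -divg_eq1 !gexpr_wordP -word_val_rev -word_val_cat.
by rewrite -reduce_val r1.
Qed.
End Reduction.
End RightAngledCoxeter.

(** Marks a hypothesis that has been collected. *)
Definition seen (P : Prop) := P.

Ltac letter_index e t :=
  lazymatch e with
  | ?u :: ?e' =>
    match constr:(Set) with
    | _ => let _ := match constr:(Set) with _ => constr_eq u t end in constr:(0%N)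
    | _ => let i := letter_index e' t in constr:(S i)
    end
  end.

Ltac reify e t :=
  match constr:(Set) with
  | _ => let i := letter_index e t in constr:(GVar i)
  | _ =>
    lazymatch t with
    | @monoid.mul _ ?u ?v => let a := reify e u in let b := reify e v in constr:(GMul a b)
    | @monoid.inv _ ?u => let a := reify e u in constr:(GInv a)
    | @monoid.conjg _ ?u ?v => let a := reify e u in let b := reify e v in constr:(GConj a b)
    | @monoid.one _ => constr:(GOne)
    end
  end.

Ltac with_involutions e pe k :=
  lazymatch goal with
  | H : @eq _ (@monoid.mul _ ?u ?u) (@monoid.one _) |- _ =>
    let P := type of H in change (seen P) in (type of H);
    with_involutions (u :: e) (@conj P _ H pe) k
  | _ => k e pe
  end.

Ltac with_commutations e ps pps k :=
  lazymatch goal with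
  | H : @monoid.commute _ ?u ?v |- _ =>
    let P := type of H in change (seen P) in (type of H);
    let p := match constr:(Set) with
      | _ => let i := letter_index e u in let j := letter_index e v in constr:(Some (i, j))
      | _ => constr:(@None (nat * nat))
      end in
    lazymatch p with
    | Some ?ij => with_commutations e (ij :: ps) (@conj P _ H pps) k
    | _ => with_commutations e ps pps k
    end
  | _ => k ps pps
  end.

(** Proves an equality (or commutation) of words in the elements that a
    hypothesis declares to be involutions, from the commutations in context. *)
Ltac coxeter :=
  try rewrite /monoid.commute;
  lazymatch goal with
  | |- @eq ?T ?t ?u =>
    with_involutions (@nil T) I ltac:(fun e pe =>
      with_commutations e (@nil (nat * nat)) I ltac:(fun ps pps =>
        let a := reify e t in let b := reify e u in
        refine (@reduce_eq _ ps e pe pps a b _); vm_compute;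
        first [reflexivity|fail 1]))
  end.

Lemma eq_by_relation (G : groupType) (u v p s g h : G) :
  u = v -> g = p * u * s -> p * v * s = h -> g = h.
Proof. by move=> -> -> ->. Qed.

(** Replaces u by v between the given prefix and suffix. *)
Ltac coxeter_by H p s := apply: (eq_by_relation (p := p) (s := s) H); try clear H; coxeter.

Section Words2.
Variable G : groupType.
Implicit Types g h k u v w : G.
Lemma pow4E u : u ^+ 4 = u * u * u * u.
Proof. by rewrite !expgS expg0 mulg1 !mulgA. Qed.

(** For involutions, <u, v> has class at most 2 exactly when u commutes with u ^ v; in
    this form the class condition is used throughout. *)
Lemma pow4_invol u v : u * u = 1 -> v * v = 1 -> commute u (u ^ v) ->
  (u * v) ^+ 4 = 1.
Proof.
move=> u2 v2 uw; have w2 := involJ v u2.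
have -> : (u * v) ^+ 4 = u * u ^ v * (u * u ^ v).
  by rewrite pow4E (conj_invol _ v2) !mulgA.
by coxeter.
Qed.

Lemma square_invol u v : u * u = 1 -> v * v = 1 -> commute u (u ^ v) ->
  [/\ commute (u * v * u * v) u, commute (u * v * u * v) v
    & u * v * u * v * (u * v * u * v) = 1].
Proof.
move=> u2 v2 uw; have w2 := involJ v u2.
have E : u * v * u * v = u * u ^ v by rewrite conj_invol // !mulgA.
rewrite E; split; [by coxeter| |by coxeter].
by apply: commuteE; rewrite conjMg -conjgM v2 conjg1; coxeter.
Qed.

Lemma pow4_product (r m : G) : (r * m) ^+ 4 =
  r ^+ 4 * (m ^ (r ^+ 3) * m ^ (r ^+ 2) * m ^ (r ^+ 1) * m).
Proof.
by rewrite !pow4E !expgS !expg0 !mulg1 /conjg !invgM !mulgA !mulgK.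
Qed.

(** Let f be the commutator of u and v ^ a. Conjugation by u * u ^ a, the commutator
    of u and a, multiplies v by f ^ a and v ^ a by f. It fixes v * v ^ a, hence f * f
    ^ a = 1, and f is fixed by a. *)
Lemma cross_commutator (u v a : G) : u * u = 1 -> v * v = 1 -> a * a = 1 ->
  commute u v -> commute u (u ^ a) -> commute v (v ^ a) ->
  commute u (u ^ (v ^ a)) -> commute (v ^ a) ((v ^ a) ^ u) ->
  commute (u * u ^ a) (v * v ^ a) ->
  let f := u * u ^ (v ^ a) in
  [/\ commute f u, commute f v, commute f a, f * f = 1 &
    (f = u * u ^ (v * v ^ a)) /\ (f = (u * u ^ a) * (u * u ^ a) ^ v)].
Proof.
move=> u2 v2 a2 uv uua vva uuv' vvu cd f; have fE : f = u * u ^ (v ^ a) by []; clearbody f.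
have aa w : (w ^ a) ^ a = w by rewrite -conjgM a2 conjg1.
have ua2 : u ^ a * u ^ a = 1 by apply: involJ.
have va2 : v ^ a * v ^ a = 1 by apply: involJ.
have uava : commute (u ^ a) (v ^ a) by apply: commuteJ.
have f2 : f * f = 1.
  by have w2 := involJ (v ^ a) u2; rewrite fE; coxeter.
have fE' : f = (v ^ a) ^ u * v ^ a by rewrite fE; coxeter.
have fu : commute f u.
  by have w2 := involJ (v ^ a) u2; rewrite fE; coxeter.
have fva : commute f (v ^ a).
  by have w2 := involJ u va2; rewrite fE'; coxeter.
have fv : commute f v by rewrite fE; coxeter.
have fua : commute f (u ^ a) by rewrite fE; coxeter.
have fau : commute (f ^ a) u by rewrite -[u]aa; apply: commuteJ.
have fava : commute (f ^ a) (v ^ a) by apply: commuteJ.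
have fav : commute (f ^ a) v by rewrite -[v in commute _ v]aa; apply: commuteJ.
have faua : commute (f ^ a) (u ^ a) by apply: commuteJ.
have fa2 : f ^ a * f ^ a = 1 by apply: involJ.
have ffa1 : commute f (f ^ a).
  by rewrite [in f ^ a]fE conjMg (conjJg u) aa; coxeter.
(* Conjugation by u u^a multiplies v by f ^ a and v ^ a by f. *)
have vua : v ^ (u * u ^ a) = v * f ^ a.
  by rewrite -fav fE conjMg (conjJg u) aa; coxeter.
have vaua : (v ^ a) ^ (u * u ^ a) = v ^ a * f by rewrite -fva fE; coxeter.
have ffa : f * f ^ a = 1.
  have := conj_commute (commute_sym cd); rewrite conjMg vua vaua => vvE.
  apply: (mulgI (v * v ^ a)); rewrite mulg1 -[RHS]vvE.
  clear vua vaua fE fE' vvE.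
  by coxeter.
have fa : f ^ a = f.
  by rewrite -[RHS]mulg1 -ffa mulgA f2 mul1g.
split=> //; first exact: commuteE.
split; first by rewrite fE; coxeter.
by rewrite -fa fE conjMg (conjJg u) aa; coxeter.
Qed.
End Words2.

(** * Involutions with central commutators *)

Section Fin2Class2.
Variable G : groupType.
Implicit Types (g h k u v w : G) (s : seq G).

Lemma commute_generated s w : (forall u, u \in s -> commute u w) ->
  forall g, generated [set` s] g -> commute g w.
Proof. by move=> sw; apply: generated_sub => //; exact: centralizer_subgroup. Qed.

Lemma mem_generated_seq s u : u \in s -> generated [set` s] u.
Proof. by move=> us; apply: mem_generated. Qed.

(** Adjoining the squares of the products of two members, which are their
    commutators, turns the list into a tower. *)
Lemma fin2_class2 s : (forall u, u \in s -> u * u = 1) ->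
  (forall u v w, u \in s -> v \in s -> w \in s -> commute ((u * v) ^+ 2) w) ->
  fin2 (generated [set` s]).
Proof.
move=> s2 sc; set t := [seq (u * v) ^+ 2 | u <- s, v <- s].
have tP w : w \in t -> exists u v, [/\ u \in s, v \in s & w = (u * v) ^+ 2].
  by case/allpairsP => [[u v] [us vs ->]]; exists u, v.
have ts w v : w \in t -> v \in s -> commute w v.
  by case/tP => [u [u' [us us' ->]]] vs; apply: sc.
have tt w v : w \in t -> v \in t -> commute w v.
  by move=> wt /tP [u [u' [us us' ->]]]; apply/commuteX/commuteM; apply: ts.
have t2 w : w \in t -> w * w = 1.
  case/tP => [u [v [us vs ->]]]; have := sc u v u us vs us.
  by rewrite expg2 => H; have ? := s2 u us; have ? := s2 v vs; coxeter_by H (1 : G) (v * u * v).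
have towerT t' : {subset t' <= t} -> involution_tower t'.
  elim: t' => [//|w t' IH] wt'; split; first by apply/t2/wt'/mem_head.
    move=> h ht'; rewrite conj_commute; first exact: mem_generated_seq.
    by apply: tt; apply: wt'; rewrite inE ?eqxx ?ht' ?orbT.
  by apply: IH => h ht'; apply: wt'; rewrite inE ht' orbT.
have tower s' : {subset s' <= s} -> involution_tower (s' ++ t).
  elim: s' => [_|w s' IH ws'] /=; first exact: towerT.
  have ws : w \in s by apply/ws'/mem_head.
  split; [exact: s2| |by apply: IH => h hs'; apply: ws'; rewrite inE hs' orbT].
  move=> h; rewrite mem_cat => /orP [hs'|ht]; last first.
    by rewrite conj_commute; [apply: mem_generated_seq; rewrite mem_cat ht orbT|exact: ts].
  have hs : h \in s by apply: ws'; rewrite inE hs' orbT.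
  have -> : h ^ w = h * (h * w) ^+ 2.
    by rewrite expg2; have ? := s2 w ws; have ? := s2 h hs; coxeter.
  apply: (subM (generated_subgroup _)).
    by apply: mem_generated_seq; rewrite mem_cat hs'.
  apply: mem_generated_seq; rewrite mem_cat; apply/orP; right.
  by apply/allpairsP; exists (h, w).
apply: fin2_sub (fin2_tower (tower s (fun _ H => H))).
apply: generated_sub; first exact: generated_subgroup.
by move=> u us; apply: mem_generated_seq; rewrite mem_cat us.
Qed.

Lemma normaliser_subgroup (N : set G) :
  is_subgroup [set g | forall n, N (n ^ g) <-> N n].
Proof.
split=> [n|g h Ng Nh n]; first by rewrite conjg1.
by rewrite conjgM -Nh -conjgM mulVg conjg1; exact: Ng.
Qed.
End Fin2Class2.

(** * The relations between the generators *)

(** The hypotheses in a form that homomorphic images inherit: involutions may become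
    trivial or coincide, and the class condition says that u commutes with its
    conjugate by v ^ g. *)
Record sandwich_setup (G : groupType) (a x y z : G) : Prop := SandwichSetup {
  setup_gen : forall H, is_subgroup H -> H a -> H x -> H y -> H z -> forall g, H g;
  setup_a2 : a * a = 1;
  setup_x2 : x * x = 1;
  setup_y2 : y * y = 1;
  setup_z2 : z * z = 1;
  setup_ax : commute a x;
  setup_ay : commute a y;
  setup_cx : commute (z * z ^ a) (z ^ x);
  setup_cy : commute (z * z ^ a) (z ^ y);
  setup_sandwich : forall u v g, u \in [:: a; x; y; z] -> v \in [:: a; x; y; z] ->
    commute u (u ^ (v ^ g))
}.

(** The conjugates of u under the rotations of the dihedral group <x, y>. *)
HB.lock Definition rotate (G : groupType) (x y u : G) (i : nat) := u ^ ((x * y) ^+ i).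

Lemma rotateE (G : groupType) (x y u : G) i : rotate x y u i = u ^ ((x * y) ^+ i).
Proof. by rewrite unlock. Qed.

(** The product of all rotations of z appears in (x * y ^ z) ^ 4. Like the commutators
    mu and sigma of rotations of z, it is central in the group generated by the
    conjugates of z under <x, y>. *)
HB.lock Definition eta_z (G : groupType) (x y z : G) :=
  rotate x y z 3 * rotate x y z 2 * rotate x y z 1 * rotate x y z 0.
HB.lock Definition mu (G : groupType) (x y z : G) :=
  rotate x y z 0 * rotate x y z 2 * rotate x y z 0 * rotate x y z 2.
HB.lock Definition sigma (G : groupType) (x y z : G) i :=
  rotate x y z i * rotate x y z i.+1 * rotate x y z i * rotate x y z i.+1.

(** The commutator of z and a, for involutions z and a. *)
HB.lock Definition comm_za (G : groupType) (a z : G) := z * z ^ a.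

(** The analogue of eta_z for the commutator of z and a. *)
HB.lock Definition zeta (G : groupType) (a x y z : G) :=
  rotate x y (comm_za a z) 3 * rotate x y (comm_za a z) 2 * rotate x y (comm_za a z) 1
  * rotate x y (comm_za a z) 0.

(** The commutator of comm_za a z with a conjugate of z. *)
HB.lock Definition cross (G : groupType) (a x y z : G) j :=
  comm_za a z * comm_za a z ^ rotate x y (z ^ y) j.

(** The commutator of cross j and zeta. *)
HB.lock Definition theta (G : groupType) (a x y z : G) j :=
  cross a x y z j * cross a x y z j ^ zeta a x y z.

Section Setup.
Variables (G : groupType) (a x y z : G).
Hypothesis S : sandwich_setup a x y z.
Implicit Types (u v g : G).

Let a2 := setup_a2 S.
Let x2 := setup_x2 S.
Let y2 := setup_y2 S.
Let z2 := setup_z2 S.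
Let sw := setup_sandwich S.
Local Notation r := (x * y).
Local Notation rt := (rotate x y).
Local Notation c := (comm_za a z).
Local Notation Z := (rt z).
Local Notation W := (rt (z ^ y)).
Local Notation C := (rt c).
Local Notation D := (rt (c ^ y)).
Local Notation eta := (eta_z x y z).
Local Notation mu := (mu x y z).
Local Notation sigma := (sigma x y z).
Local Notation zeta := (zeta a x y z).
Local Notation cross := (cross a x y z).
Local Notation P := (rt (cross 1)).
Local Notation Q := (rt (cross 2)).
Local Notation theta := (theta a x y z).
Lemma thetaE j : theta j = cross j * cross j ^ zeta. Proof. by rewrite unlock. Qed.
Lemma crossE j : cross j = c * c ^ W j. Proof. by rewrite unlock. Qed.
Lemma zetaE : zeta = C 3 * C 2 * C 1 * C 0. Proof. by rewrite unlock. Qed.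
Lemma cE : c = z * z ^ a. Proof. by rewrite unlock. Qed.
Lemma etaE : eta = Z 3 * Z 2 * Z 1 * Z 0. Proof. by rewrite unlock. Qed.
Lemma mu02 : mu = Z 0 * Z 2 * Z 0 * Z 2. Proof. by rewrite unlock. Qed.
Lemma sigmaE i : sigma i = Z i * Z i.+1 * Z i * Z i.+1. Proof. by rewrite unlock. Qed.

Lemma in_gens : [/\ a \in [:: a; x; y; z], x \in [:: a; x; y; z],
  y \in [:: a; x; y; z] & z \in [:: a; x; y; z]].
Proof. by rewrite !inE !eqxx !orbT. Qed.
Let ina : a \in [:: a; x; y; z]. Proof. by case: in_gens. Qed.
Let inx : x \in [:: a; x; y; z]. Proof. by case: in_gens. Qed.
Let iny : y \in [:: a; x; y; z]. Proof. by case: in_gens. Qed.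
Let inz : z \in [:: a; x; y; z]. Proof. by case: in_gens. Qed.
Lemma rot4 : r ^+ 4 = 1.
Proof. by apply: pow4_invol => //; rewrite -[y]conjg1; apply: sw. Qed.

Lemma rotateD u i j : rt u i ^ (r ^+ j) = rt u (i + j).
Proof. by rewrite !rotateE -conjgM -expgnDr. Qed.
Lemma rotate0 u : rt u 0 = u. Proof. by rewrite !rotateE expg0 conjg1. Qed.
Lemma rotateS u i : rt u i ^ r = rt u i.+1.
Proof. by rewrite -[in X in _ ^ X](expg1 r) rotateD addn1. Qed.
Lemma rotate4 u i : rt u i.+4 = rt u i.
Proof. by rewrite -addn4 -rotateD rot4 conjg1. Qed.
Lemma rotate_mod u i : rt u i = rt u (i %% 4).
Proof.
by rewrite {1}(divn_eq i 4) mulnC addnC !rotateE expgnDr expgnA rot4 expg1n mulg1.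
Qed.
Lemma rotate_eqmod u i j : i = j %[mod 4] -> rt u i = rt u j.
Proof. by rewrite (rotate_mod u i) (rotate_mod u j) => ->. Qed.

Lemma rot3 : r ^+ 3 = r^-1.
Proof. by apply: (mulIg r); rewrite -expgSr rot4 mulVg. Qed.
Lemma rot_y : r ^ y = r ^+ 3.
Proof.
by rewrite rot3 invgM !involV // /conjg involV // !mulgA involK.
Qed.
Lemma rotate_y u i : rt u i ^ y = rt (u ^ y) (3 * i).
Proof. by rewrite !rotateE conjJg conjXg rot_y expgnA. Qed.
Lemma x_rot : x = r * y. Proof. by rewrite involK. Qed.
Lemma rotate_x u i : rt u i ^ x = rt (u ^ y) (3 * i.+1).
Proof. by rewrite {2}x_rot conjgM rotateS rotate_y. Qed.

Lemma commute_rotate n u v i j :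
  commute (rt u i) (rt v j) -> commute (rt u (i + n)) (rt v (j + n)).
Proof. by move/(commuteJ (r ^+ n)); rewrite !rotateD. Qed.
Lemma commute_a_rot n : commute a (r ^+ n).
Proof. by apply/commuteX/commuteM; [exact: setup_ax S|exact: setup_ay S]. Qed.
Lemma rotate_a u i : rt u i ^ a = rt (u ^ a) i.
Proof.
rewrite !rotateE conjJg (conj_commute (commute_sym (commute_a_rot i))) //.
Qed.
Lemma commute_a_rotate u i : commute u a -> commute (rt u i) a.
Proof.
by move=> ua; rewrite rotateE; apply: commute_conjl => //; exact: commute_a_rot.
Qed.

Lemma involR u i : u * u = 1 -> rt u i * rt u i = 1.
Proof. by rewrite rotateE; apply: involJ. Qed.

Lemma rotateM u v i : rt (u * v) i = rt u i * rt v i.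
Proof. by rewrite !rotateE conjMg. Qed.
Lemma involZ i : Z i * Z i = 1. Proof. exact: involR. Qed.
Lemma involW i : W i * W i = 1. Proof. exact/involR/involJ. Qed.

Lemma central_of u : commute u a -> commute u r -> commute u y -> commute u z ->
  forall g, commute u g.
Proof.
move=> ua ur uy uz g; apply/commute_sym.
apply: (setup_gen S (centralizer_subgroup u)) => /=; try exact: commute_sym.
by rewrite x_rot; apply/commute_sym/commuteM.
Qed.

Lemma rotate_yy u i : rt (u ^ y) i ^ y = rt u (3 * i).
Proof. by rewrite rotate_y -conjgM y2 conjg1. Qed.

Lemma rotate_yx u i : rt (u ^ y) i ^ x = rt u (3 * i.+1).
Proof. by rewrite rotate_x -conjgM y2 conjg1. Qed.

(** * The conjugates of z under x and y *)

Lemma sandwich_conj u v g h : u \in [:: a; x; y; z] -> v \in [:: a; x; y; z] ->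
  commute (u ^ g) ((u ^ g) ^ (v ^ h)).
Proof.
move=> iu iv; have := commuteJ g (sw (h * g^-1) iu iv).
by rewrite [X in commute _ X]conjJg -(conjgM v) mulgVK.
Qed.

(** The elements y * r ^+ i are the reflections of the dihedral group <x, y>. *)
Lemma refl_conj i : exists s g, s \in [:: x; y] /\ y * r ^+ i = s ^ g.
Proof.
have: (i %% 4 < 4)%N by rewrite ltn_mod.
have -> : r ^+ i = r ^+ (i %% 4).
  by rewrite {1}(divn_eq i 4) mulnC expgnDr expgnA rot4 expg1n mul1g.
case: (i %% 4) => [|[|[|[|//]]]] _.
- by exists y, 1; rewrite !inE eqxx orbT expg0 mulg1 conjg1.
- by exists x, y; rewrite !inE eqxx expg1 conj_invol // mulgA.
- exists y, r; rewrite !inE eqxx orbT; split=> //.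
  by rewrite expg2 /conjg invgM !involV // !mulgA.
- exists x, 1; rewrite !inE eqxx conjg1; split=> //.
  by rewrite rot3 invgM !involV // mulgA y2 mul1g.
Qed.

Lemma sandwich_refl u i : u \in [:: a; x; y; z] -> commute u (u ^ (y * r ^+ i)).
Proof.
move=> iu; have [s [g [is_ ->]]] := refl_conj i; apply: sw => //.
by move: is_; rewrite !inE => /orP [] ->; rewrite !orbT.
Qed.

Lemma commute_rotates u v : (forall j, commute u (rt v j)) ->
  forall i j, commute (rt u i) (rt v j).
Proof.
move=> uv i j; have := commute_rotate i (_ : commute (rt u 0) (rt v (j + 3 * i))).
rewrite rotate0 => /(_ (uv _)); rewrite (@rotate_eqmod v _ j) //.
by rewrite -addnA [(3 * i + i)%N]addnC -mulSn mulnC addnC modnMDl.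
Qed.

Lemma commute_reflections u i : u \in [:: a; x; y; z] -> commute u (rt (u ^ y) i).
Proof. by move=> iu; rewrite !rotateE -conjgM; exact: sandwich_refl. Qed.

(** The sandwich condition for z and the reflections y * r ^+ j. *)
Lemma commuteZW i j : commute (Z i) (W j).
Proof.
by apply: commute_rotates => {i}j; apply: commute_reflections.
Qed.

Ltac norm_index := repeat match goal with |- context [rotate x y ?u ?i] =>
  let j := eval vm_compute in (modn i 4) in
  tryif constr_eq i j then fail else
    rewrite (_ : rotate x y u i = rotate x y u j); last exact: rotate_eqmod
  end.
Ltac index_facts l :=
  have ? := l 0%N; have ? := l 1%N; have ? := l 2%N; have ? := l 3%N.
Ltac pair_facts l :=
  index_facts (l 0%N); index_facts (l 1%N); index_facts (l 2%N); index_facts (l 3%N).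
Ltac offset_facts l :=
  have := l 0%N; norm_index; move=> ?; have := l 1%N; norm_index; move=> ?;
  have := l 2%N; norm_index; move=> ?; have := l 3%N; norm_index; move=> ?.
Ltac facts_Z := index_facts involZ.
Ltac facts_W := index_facts involW.
Ltac facts_K := facts_Z; facts_W; pair_facts commuteZW.

Lemma conj_y_by u : u * u = 1 -> y ^ u = y * (u ^ y * u).
Proof. by move=> u2; coxeter. Qed.

(** Expands (x * y ^ u) ^ 4 = 1 along x * y ^ u = r * (u ^ y * u) and r ^ 4 = 1. *)
Lemma dihedral_norm u : u * u = 1 -> commute x (x ^ (y ^ u)) ->
  rt (u ^ y * u) 3 * rt (u ^ y * u) 2 * rt (u ^ y * u) 1 * rt (u ^ y * u) 0 = 1.
Proof.
move=> u2 xyu; have := pow4_invol x2 (involJ u y2) xyu.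
by rewrite conj_y_by // mulgA pow4_product rot4 mul1g !rotateE expg0 conjg1.
Qed.

(** By [dihedral_norm] for u = z, in which the Z and the W can be separated. Hence eta
    commutes with both families. *)
Lemma etaW : eta = W 0 * W 1 * W 2 * W 3.
Proof.
have := dihedral_norm z2 (sw _ inx iny); rewrite !(rotateM (z ^ y) z) => n1.
rewrite -[RHS]mulg1 -n1 etaE; facts_K; clear n1; coxeter.
Qed.

Lemma commute_etaZ i : commute eta (Z i).
Proof. by rewrite etaW; do 3!(apply: commuteMl; last exact/commute_sym/commuteZW);
  exact/commute_sym/commuteZW. Qed.
Lemma commute_etaW i : commute eta (W i).
Proof. by rewrite etaE; do 3!(apply: commuteMl; last exact: commuteZW); exact: commuteZW. Qed.

Lemma eta_rot : eta ^ r = eta.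
Proof.
rewrite {1}etaE !(conjMg _ _ r) !rotateS rotate4 -[RHS](conj_commute (commute_etaZ 0)) etaE.
by facts_Z; coxeter.
Qed.
Lemma eta_y : eta ^ y = eta.
Proof.
rewrite {1}etaE !(conjMg _ _ y) !rotate_y -[RHS](conj_commute (commute_etaW 0)) etaW.
norm_index.
by facts_W; coxeter.
Qed.

Lemma rot_mod i : r ^+ i = r ^+ (i %% 4).
Proof. by rewrite {1}(divn_eq i 4) mulnC expgnDr expgnA rot4 expg1n mul1g. Qed.

Lemma half_turn_norm i j : (r ^+ 2 * (W i * Z j)) ^+ 4 = 1 ->
  W i.+2 * Z j.+2 * (W i * Z j) * (W i.+2 * Z j.+2) * (W i * Z j) = 1.
Proof.
rewrite pow4_product -!expgnA !(rot_mod (2 * _)) /= expg0 mul1g conjg1.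
by rewrite !(conjMg (W i)) !rotateD !addn2.
Qed.

(** The class condition for x and x ^ (z * r), and below for y and y ^ (z * r): the
    product of the two involutions is a half turn up to conjugates of z, so its fourth
    power is a word in the Z and W. *)
Lemma square_WZ_x : W 2 * W 0 * W 2 * W 0 * (Z 3 * Z 1 * Z 3 * Z 1) = 1.
Proof.
have := pow4_invol x2 (involJ (z * r) x2) (sw (z * r) inx inx).
have -> : x * x ^ (z * r) = r ^+ 2 * (W 0 * Z 1).
  have -> : x ^ (z * r) = x ^ r * (W 3 ^ r * Z 0 ^ r).
    rewrite conjgM -!conjMg; congr (_ ^ _).
    by have := rotate_x z 0; rewrite rotate0 => <-; coxeter.
  by rewrite !rotateS rotate4 expg2 !mulgA; congr (_ * _ * _); coxeter.
move/half_turn_norm => n1; rewrite -[RHS]n1; clear n1.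
by facts_K; coxeter.
Qed.
Lemma square_WZ_y : W 3 * W 1 * W 3 * W 1 * (Z 3 * Z 1 * Z 3 * Z 1) = 1.
Proof.
have := pow4_invol y2 (involJ (z * r) y2) (sw (z * r) iny iny).
have -> : y * y ^ (z * r) = r ^+ 2 * (W 1 * Z 1).
  have -> : y ^ (z * r) = y ^ r * (W 0 ^ r * Z 0 ^ r).
    by rewrite conjgM -!conjMg rotate0 rotate0 -conj_y_by.
  by rewrite !rotateS expg2 !mulgA; congr (_ * _ * _); coxeter.
move/half_turn_norm => n1; rewrite -[RHS]n1; clear n1.
by facts_K; coxeter.
Qed.

(** A word in the Z equal to a word in the W commutes with both families. *)
Lemma square_Z13 : Z 1 * Z 3 * Z 1 * Z 3 = W 2 * W 0 * W 2 * W 0.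
Proof.
rewrite -[LHS]mul1g -square_WZ_x; facts_K; coxeter.
Qed.
Lemma square_Z02 : Z 0 * Z 2 * Z 0 * Z 2 = W 2 * W 0 * W 2 * W 0.
Proof.
have := congr1 (fun g => g ^ x) square_WZ_y.
rewrite !(conjMg _ _ x) conj1g !rotate_yx !rotate_x; norm_index.
move=> n1; rewrite -[RHS]mul1g -n1; clear n1.
by facts_K; coxeter.
Qed.

Lemma muE : mu = Z 1 * Z 3 * Z 1 * Z 3.
Proof. by rewrite mu02 square_Z13 -square_Z02. Qed.

Lemma commute_muZ i : commute mu (Z i).
Proof.
rewrite mu02 square_Z02.
by do 3!(apply: commuteMl; last exact/commute_sym/commuteZW); exact/commute_sym/commuteZW.
Qed.
Lemma sandwichZ i j : commute (Z i) (Z i ^ Z j).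
Proof. by rewrite !rotateE; apply: sandwich_conj. Qed.
Lemma squareZ i j : [/\ commute (Z i * Z j * Z i * Z j) (Z i),
  commute (Z i * Z j * Z i * Z j) (Z j)
  & Z i * Z j * Z i * Z j * (Z i * Z j * Z i * Z j) = 1].
Proof. by apply: square_invol; [exact: involZ|exact: involZ|exact: sandwichZ]. Qed.

Lemma sigma_rot i : sigma i ^ r = sigma i.+1.
Proof. by rewrite !sigmaE !(conjMg _ _ r) !rotateS. Qed.

Lemma mu_rot : mu ^ r = mu.
Proof. by rewrite {1}mu02 !(conjMg _ _ r) !rotateS muE. Qed.

(** Z 3 = eta * Z 0 * Z 1 * Z 2 has square 1; bringing equal letters of the square
    together exchanges Z 2 and Z 0, at the cost of the central mu. *)
Lemma eta_square0 : eta * eta * (mu * sigma 0 * sigma 1) = 1.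
Proof.
have m1 := commute_muZ 1; have m2 := commute_muZ 2; have m0 := commute_muZ 0.
have [_ _ mm] := squareZ 0 2; rewrite -mu02 in mm.
have E02 : Z 2 * Z 0 = Z 0 * Z 2 * mu.
  rewrite -[LHS]mulg1 -mm mu02; clear mm; by facts_Z; coxeter.
have E3 : Z 3 = eta * Z 0 * Z 1 * Z 2 by rewrite etaE; clear mm; facts_Z; coxeter.

have ew : commute eta (Z 0 * Z 1 * Z 2) 
  by rewrite -!mulgA; do 2!(apply: commuteM; first exact: commute_etaZ); exact: commute_etaZ.

have Z3 := involZ 3; rewrite E3 -!(mulgA eta) (commuteAl _ (commute_sym ew)) in Z3.
rewrite -[RHS]Z3 -[LHS]mulgA; congr (_ * (_ * _)); clear Z3 E3 mm ew.
rewrite !mulgA -(mulgA _ (Z 2) (Z 0)) E02 -!mulgA.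
rewrite -(commuteAl _ m2) -!(commuteAl _ m0) -(commuteAl _ m1) -!(commuteAl _ m0).
by congr (_ * _); rewrite !sigmaE !mulgA; facts_Z; coxeter.
Qed.
Lemma eta_square i : eta * eta * (mu * sigma i * sigma i.+1) = 1.
Proof.
elim: i => [|i /(congr1 (conjg^~ r)) /=]; first exact: eta_square0.
by rewrite !(conjMg _ _ r) conj1g eta_rot mu_rot !sigma_rot.
Qed.

(** The class condition makes sigma i commute with Z i and Z (i + 1); by [eta_square]
    it is also a word in eta, mu and the next or the previous sigma, and so commutes
    with the other two rotations of z. *)
Lemma commute_sigmaZ i j : commute (sigma i) (Z j).
Proof.
have s0 k : commute (sigma k) (Z k) by rewrite sigmaE; case: (squareZ k k.+1).
have s1 k : commute (sigma k) (Z k.+1) by rewrite sigmaE; case: (squareZ k k.+1).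
have s2 k : commute (sigma k) (Z k.+2).
  apply/commute_sym; have := commute1 (Z k.+2); rewrite -(eta_square k).
  have ee : commute (Z k.+2) (eta * eta) by apply: commuteM; apply/commute_sym/commute_etaZ.
  move/commuteMK => /(_ ee) /commuteMKl /(_ (commute_sym (s1 _))) /commuteMK; apply.
  exact/commute_sym/commute_muZ.
have s3 k : commute (sigma k.+1) (Z k).
  apply/commute_sym; have := commute1 (Z k); rewrite -(eta_square k).
  have ee : commute (Z k) (eta * eta) by apply: commuteM; apply/commute_sym/commute_etaZ.
  move/commuteMK => /(_ ee) /commuteMK; apply; apply: commuteM; apply: commute_sym => //.
  exact: commute_muZ.
have s4 k : sigma k.+4 = sigma k by rewrite !sigmaE !rotate4.
have -> : Z j = Z (i + (j + 3 * i) %% 4).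
  apply: rotate_eqmod; rewrite modnDmr addnA [(i + j)%N]addnC -addnA -mulSn.
  by rewrite addnC mulnC modnMDl.
have: ((j + 3 * i) %% 4 < 4)%N by rewrite ltn_mod.
case: (_ %% 4) => [|[|[|[|//]]]] _; rewrite ?addnS addn0.
- exact: s0.
- exact: s1.
- exact: s2.
- by rewrite -s4; exact: s3.
Qed.

Lemma sigma_conj i : Z i ^ Z i.+1 = Z i * sigma i.
Proof. by rewrite sigmaE; have ? := involZ i; have ? := involZ i.+1; coxeter. Qed.

(** Conjugation by Z 1 fixes eta and multiplies its factors by mu, sigma 1 and sigma
    0. So mu * sigma 0 * sigma 1 = 1, and [eta_square] gives the claim. *)
Lemma eta2 : eta * eta = 1.
Proof.
have s i j := commute_sigmaZ i j.
have := conj_commute (commute_etaZ 1).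
rewrite {1}etaE !(conjMg _ _ (Z 1)) sigma_conj.
have -> : Z 3 ^ Z 1 = mu * Z 3 by rewrite muE; facts_Z; coxeter.
have -> : Z 2 ^ Z 1 = sigma 1 * Z 2 by rewrite sigmaE; facts_Z; coxeter.
rewrite (conj_commute (erefl : commute (Z 1) (Z 1))) !mulgA -(mulgA _ (Z 0)).
rewrite -(s 0%N 0%N) !mulgA.
have s10 : commute (sigma 1) (sigma 0) 
  by rewrite (sigmaE 0) -!mulgA; do 3!(apply: commuteM; first exact: s); exact: s.
have -> : mu * Z 3 * sigma 1 * Z 2 * Z 1 * sigma 0 * Z 0 = mu * sigma 0 * sigma 1 * eta.
  by rewrite etaE -!mulgA -!(commuteAl _ (s _ _)) !mulgA (commuteA _ s10).
move/(canRL (mulgK eta)); rewrite mulgV => H.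
by have := eta_square 0; rewrite H mulg1.
Qed.

(** * The conjugates of a *)

(** The sandwich condition for a and a reflection s, conjugated by h: as s
    commutes with a, it compares a ^ h with a ^ (h ^ s) for every h. *)
Lemma commute_a_conj h i : commute (a ^ h) (a ^ (h ^ (y * r ^+ i))).
Proof.
have [s [g [is_ sE]]] := refl_conj i; rewrite sE.
have ca : a ^ (s ^ g) = a.
  by rewrite -sE; apply/conj_commute/commuteM; [exact: setup_ay S|exact: commute_a_rot].
have iS : s \in [:: a; x; y; z] by move: is_; rewrite !inE => /orP [] ->; rewrite !orbT.
have := commuteJ h (sw (g * h^-1) ina iS).
have -> : (a ^ (s ^ (g * h^-1))) ^ h = a ^ (h ^ (s ^ g)) => [|//].
rewrite -[in RHS]ca -!(conjgM a); congr (_ ^ _).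
by rewrite -conjgC conjgM [_ ^ h^-1]/conjg invgK !mulgA mulgVK.
Qed.

(** * The conjugates of the commutator c of z and a *)

Lemma commute_zza : commute z (z ^ a). Proof. by rewrite -[a]conjg1; exact: sw. Qed.
Lemma c2 : c * c = 1.
Proof. by rewrite cE; have ? := commute_zza; have ? := involJ a z2; coxeter. Qed.
Lemma commute_ca : commute c a.
Proof.
have ? := commute_zza; have ? := involJ a z2.
by apply: commuteE; rewrite cE conjMg -conjgM a2 conjg1; coxeter.
Qed.
Lemma commute_cz : commute c z.
Proof. by rewrite cE; have ? := commute_zza; have ? := involJ a z2; coxeter. Qed.

Lemma involC i : C i * C i = 1. Proof. exact/involR/c2. Qed.
Lemma involD i : D i * D i = 1. Proof. exact/involR/involJ/c2. Qed.
Lemma commute_aC i : commute a (C i).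
Proof. exact/commute_sym/commute_a_rotate/commute_ca. Qed.
Lemma commute_aD i : commute a (D i).
Proof.
apply/commute_sym/commute_a_rotate/commute_conjl; first exact: commute_ca.
exact: setup_ay S.
Qed.
Lemma commute_rotate_both u v i : commute u v -> commute (rt u i) (rt v i).
Proof. by rewrite !rotateE; apply: commuteJ. Qed.
Lemma commute_czy : commute c (z ^ y). Proof. rewrite cE; exact: setup_cy S. Qed.
Lemma commute_czx : commute c (z ^ x). Proof. rewrite cE; exact: setup_cx S. Qed.
Lemma commuteDW i : commute (D i) (W i).
Proof. exact/commute_rotate_both/commuteJ/commute_cz. Qed.
Lemma commuteCW0 i : commute (C i) (W i).
Proof. exact/commute_rotate_both/commute_czy. Qed.
Lemma commuteCW3 i : commute (C i) (W (i + 3)).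
Proof.
rewrite addnC -rotateD (rotateE x y c); apply: commuteJ.
by have := rotate_x z 0; rewrite !rotate0 => <-; exact: commute_czx.
Qed.
Lemma commuteDZ0 i : commute (D i) (Z i).
Proof.
by have := commuteJ y commute_czy; rewrite -conjgM y2 conjg1; apply: commute_rotate_both.
Qed.
Lemma commuteDZ1 i : commute (D i) (Z i.+1).
Proof.
rewrite -add1n -rotateD (rotateE x y (c ^ y)); apply: commuteJ.
have := commuteJ y commute_czx; rewrite (_ : (z ^ x) ^ y = Z 1) //.
by rewrite -conjgM rotateE expg1.
Qed.

(** The form taken by [commute_a_conj] once a ^ h is written as a e. *)
Lemma commute_a_factor h e i : a ^ h = a * e -> commute a e ->
  commute e (e ^ (y * r ^+ i)).
Proof.
move=> hE ae; set t := y * r ^+ i.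
have ta : a ^ t = a by apply/conj_commute/commuteM; [exact: setup_ay S|exact: commute_a_rot].
have := commute_a_conj h i; rewrite -/t.
have -> : a ^ (h ^ t) = a * e ^ t.
  by rewrite -{1}ta -conjJg hE conjMg ta.
rewrite hE => H; have aet : commute a (e ^ t).
  by rewrite -{1}ta; apply: commuteJ.
have aea : commute (a * e) a by apply: commuteMl => //; exact: commute_sym.
have ete := commuteMK H aea.
by apply: commute_sym; apply: commuteMK (commute_sym ete) _; exact: commute_sym.
Qed.

Lemma conj_a u : u * u = 1 -> a ^ u = a * (u * u ^ a) ^ a.
Proof. by move=> u2; coxeter. Qed.
Lemma conj_aZ i : a ^ Z i = a * C i.
Proof.
by rewrite conj_a ?involZ // rotate_a -rotateM -cE (conj_commute (commute_sym (commute_aC i))).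
Qed.

Lemma conj_aW i : a ^ W i = a * D i.
Proof.
rewrite conj_a // ?rotate_a ?involW // -rotateM.
have -> : z ^ y * (z ^ y) ^ a = c ^ y.
  by rewrite cE conjMg -!conjgM (setup_ay S).
by rewrite (conj_commute (commute_sym (commute_aD i))).
Qed.

(** This is [commute_a_conj] for h = z, as a ^ z = a * c. *)
Lemma commuteCD i j : commute (C i) (D j).
Proof.
move: i j; apply: commute_rotates => j.
have := commute_a_factor j (conj_aZ 0) (commute_aC 0).
by rewrite rotate0 !rotateE conjgM.
Qed.

Lemma rotate_yr u i j : rt u i ^ (y * r ^+ j) = rt (u ^ y) (3 * i + j).
Proof. by rewrite conjgM rotate_y rotateD. Qed.
Lemma rotate_yyr u i j : rt (u ^ y) i ^ (y * r ^+ j) = rt u (3 * i + j).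
Proof. by rewrite conjgM rotate_yy rotateD. Qed.

Lemma conj_aZW i j : a ^ (Z i * W j) = a * (D j * C i ^ W j).
Proof. by rewrite conjgM conj_aZ conjMg conj_aW -(mulgA a). Qed.

(** These are [commute_a_conj] for h = Z 0 * W 0 and for h = Z 0 * W 3, the products
    of conjugates of z that act on a through a C and a D. *)
Lemma commute_CD_pairs : commute (C 0 * D 0) (C 1 * D 1) /\ commute (C 0 * D 3) (C 1 * D 0).
Proof.
have H i j k : commute (C i) (W j) -> commute (C i * D j) (D (3 * i + k) * C (3 * j + k)).
  move=> CW; have := conj_aZW i j; rewrite (conj_commute CW) -(commuteCD i j).
  move/commute_a_factor => /(_ k); rewrite conjMg rotate_yr rotate_yyr; apply.
  by apply: commuteM; [exact: commute_aC|exact: commute_aD].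
split.
  by have := H 0%N 0%N 1%N (commuteCW0 0); norm_index; rewrite -commuteCD.
by have := H 0%N 3%N 0%N (commuteCW3 0); norm_index; rewrite -commuteCD.
Qed.

(** The relations of [commute_CD_pairs] compare the commutator of C 0 and C 1 with
    commutators of the D. *)
Lemma nu_reversals : C 0 * C 1 * C 0 * C 1 = D 1 * D 0 * D 1 * D 0 /\
  C 0 * C 1 * C 0 * C 1 = D 0 * D 3 * D 0 * D 3.
Proof.
have [H1 H2] := commute_CD_pairs; index_facts involC; index_facts involD; pair_facts commuteCD.
split.
  by clear H2; coxeter_by H1 (C 0 * C 1) (D 1 * D 0).
by clear H1; coxeter_by H2 (C 0 * C 1) (D 0 * D 3).
Qed.

Lemma nu_rot : (C 0 * C 1 * C 0 * C 1) ^ r = C 0 * C 1 * C 0 * C 1.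
Proof.
have [E1 E2] := nu_reversals.
by rewrite {1}E2 !(conjMg _ _ r) !rotateS rotate4 -E1.
Qed.
Lemma nu_y : (C 0 * C 1 * C 0 * C 1) ^ y = C 0 * C 1 * C 0 * C 1.
Proof.
by have [_ E] := nu_reversals; rewrite {1}E !(conjMg _ _ y) !rotate_yy; norm_index.
Qed.
(** By [nu_reversals] the commutator of C 0 and C 1 is fixed by r and y. It commutes
    with W 0, which commutes with C 0 and C 1, and hence with z. *)
Lemma nu_central g : commute (C 0 * C 1 * C 0 * C 1) g.
Proof.
apply: central_of g.
- by do 3!(apply: commuteMl; last exact/commute_sym/commute_aC); exact/commute_sym/commute_aC.
- exact/commuteE/nu_rot.
- exact/commuteE/nu_y.
- apply: (commuteJK (g := y)); rewrite nu_y -[z ^ y]rotate0.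
  have H0 := commuteCW0 0; have H1 : commute (C 1) (W 0) by have := commuteCW3 1; norm_index.
  by do 3!(apply: commuteMl => //).
Qed.

(** By [dihedral_norm] for u = c. *)
Lemma zetaD : zeta = D 0 * D 1 * D 2 * D 3.
Proof.
rewrite zetaE; have := dihedral_norm c2 (sw _ inx iny); rewrite !(rotateM (c ^ y) c) => n1.
index_facts involC; index_facts involD; pair_facts commuteCD.
by coxeter_by n1 (D 0 * D 1 * D 2 * D 3) (1 : G).
Qed.

Lemma nu_square : C 0 * C 1 * C 0 * C 1 * (C 0 * C 1 * C 0 * C 1) = 1.
Proof.
have := conj_commute (nu_central (C 0)); index_facts involC => H; rewrite -{2}H; clear H.
by coxeter.
Qed.

(** * The commutators P and Q of conjugates of c and z *)

(** The commutator of C 0 and C 1 is a central involution, to be factored out. The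
    relations for theta, delta and omega assumed below are of the same kind. *)
Hypothesis nu1 : C 0 * C 1 * C 0 * C 1 = 1.

(** Neighbours commute because their commutator is trivial. As zeta = C 3 * C 2 * C 1
    * C 0 is also a word in the D, it commutes with C 0, and then so does C 2. *)
Lemma commuteCC i j : commute (C i) (C j).
Proof.
have C01 : commute (C 0) (C 1).
  by index_facts involC; coxeter_by nu1 (1 : G) (C 1 * C 0).
have C10 k : commute (C k) (C k.+1).
  by have := commute_rotate k C01; rewrite add0n add1n.
have C02 : commute (C 0) (C 2).
  have C30 := C10 3%N; rewrite rotate4 in C30.
  have H : commute (C 3 * C 2 * C 1 * C 0) (C 0).
    by rewrite -zetaE zetaD; pair_facts commuteCD; index_facts involC; index_facts involD; coxeter.
  clear nu1; index_facts involC.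
  by coxeter_by H (C 0 * C 3) (C 1).
apply: commute_rotates => {}j; rewrite rotate_mod -[X in commute X](rotate0 c).
have : (j %% 4 < 4)%N by rewrite ltn_mod.
case: (j %% 4) => [|[|[|[|//]]]] _ //.
by apply/commute_sym; have := C10 3%N; rewrite rotate4.
Qed.
Lemma commuteDD i j : commute (D i) (D j).
Proof.
move: i j; apply: commute_rotates => j; rewrite -[X in commute X](rotate0 (c ^ y)).
apply: (commuteJK (g := y)); rewrite !rotate_yy; exact: commuteCC.
Qed.
(** By [cross_commutator] for z and W j: the commutator of c and W j is also the
    commutator of z and D j, and it commutes with whatever either expression allows. *)
Lemma crossP j : [/\ commute (cross j) z, commute (cross j) (W j),
  commute (cross j) a, cross j * cross j = 1 & cross j = z * z ^ D j].
Proof.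
rewrite crossE.
have swa g h : commute (z ^ g) ((z ^ g) ^ (z ^ h)) by apply: sandwich_conj.
have WE k : W k = z ^ (y * r ^+ k) by rewrite rotateE conjgM.
have := @cross_commutator G z (W j) a z2 (involW j) a2.
have -> : W j * W j ^ a = D j.
  rewrite rotate_a -rotateM cE; congr (rotate _ _ _ _).
  by rewrite conjMg -!conjgM (setup_ay S).
rewrite -cE => H; have [] := H.
- exact: commute_reflections.
- exact: commute_zza.
- rewrite rotate_a !rotateE; apply: commuteJ; rewrite -conjgM -(setup_ay S) conjgM.
  exact/commuteJ/commute_zza.
- by have := swa 1 (y * r ^+ j * a); rewrite conjg1 (conjgM z) -WE.
- by have := swa (y * r ^+ j * a) 1; rewrite conjg1 (conjgM z) -WE.
- by rewrite -[c in commute c]rotate0; apply: commuteCD.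
by move=> H1 H2 H3 H4 [H5 H6]; rewrite -H6.
Qed.

Lemma cross_square j : cross j * cross j = 1. Proof. by case: (crossP j). Qed.
Lemma commute_cross_z j : commute (cross j) z. Proof. by case: (crossP j). Qed.
Lemma commute_cross_W j : commute (cross j) (W j). Proof. by case: (crossP j). Qed.
Lemma commute_cross_a j : commute (cross j) a. Proof. by case: (crossP j). Qed.
Lemma cross_D j : cross j = z * z ^ D j. Proof. by case: (crossP j). Qed.

Lemma commute_cross_c j : commute (cross j) c.
Proof.
have cz := commute_cross_z j; rewrite cE; apply: commuteM => //; apply: commute_conj => //.
exact: commute_cross_a.
Qed.
Lemma commute_cross_Dj j : commute (cross j) (D j).
Proof.
have -> : D j = a^-1 * a ^ W j by rewrite conj_aW mulKg.
apply: commuteM; first exact/commuteV/commute_cross_a.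
by apply: commute_conj; [exact: commute_cross_a|exact: commute_cross_W].
Qed.
Lemma commute_cross_C j k : commute (C k) (W j) -> commute (cross j) (C k).
Proof.
move=> CW; apply: commute_sym; rewrite crossE.
have Cc : commute (C k) c by rewrite -[c in commute _ c]rotate0; apply: commuteCC.
by apply: commuteM => //; apply: commute_conj.
Qed.
Lemma commute_cross_D j k : commute (D k) z -> commute (cross j) (D k).
Proof.
move=> Dz; apply: commute_sym; rewrite cross_D.
by apply: commuteM => //; apply: commute_conj => //; apply: commuteDD.
Qed.

Lemma conj_W_C j n : W (j + n) ^ C n = rt (cross j) n * W (j + n).
Proof.
have : W j ^ c = cross j * W j.
  by rewrite crossE; have ? := c2; have ? := involW j; coxeter.
by move/(congr1 (conjg^~ (r ^+ n))); rewrite /= conjJg (conjMg (cross j)) rotateD -!rotateE.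
Qed.
Lemma conj_Z_D j n : Z n ^ D (j + n) = rt (cross j) n * Z n.
Proof.
have : z ^ D j = cross j * z.
  rewrite (commute_cross_z j) cross_D.
  by have ? := involD j; coxeter.
by move/(congr1 (conjg^~ (r ^+ n))); rewrite /= conjJg (conjMg (cross j)) rotateD -!rotateE.
Qed.

(** Conjugation by y exchanges the two expressions of cross j as a commutator. *)
Lemma cross_y j : cross j ^ y = rt (cross j) (3 * j).
Proof.
have E : rt (cross j) (3 * j) = C (3 * j) * C (3 * j) ^ W 0.
  rewrite crossE rotateM [rt (c ^ _) _]rotateE conjJg -rotateE rotateD.
  by rewrite (_ : W (j + 3 * j) = W 0) //; apply: rotate_eqmod; rewrite -mulSn modnMr.
have H := involR (3 * j) (cross_square j); rewrite -[RHS](involV H) E cross_D.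
rewrite conjMg conjJg rotate_yy rotate0.
by have ? := involC (3 * j); have ? := involJ y z2; coxeter.
Qed.

Lemma commute_shift u v k n : commute u (rt v k) -> commute (rt u n) (rt v (k + n)).
Proof. by move/(commuteJ (r ^+ n)); rewrite rotateD -rotateE. Qed.

(** Rotations have period 4. *)
Lemma commute_offsets u v : (forall i, commute (rt u i) (rt v i)) ->
  (forall i, commute (rt u i) (rt v i.+1)) -> (forall i, commute (rt u i) (rt v i.+2)) ->
  (forall i, commute (rt u i) (rt v i.+3)) -> forall i j, commute (rt u i) (rt v j).
Proof.
move=> h0 h1 h2 h3; apply: commute_rotates => j; rewrite rotate_mod -[u]rotate0.
have : (j %% 4 < 4)%N by rewrite ltn_mod.
by case: (j %% 4) => [|[|[|[|//]]]] _.
Qed.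
Lemma commute_D3z : commute (D 3) z.
Proof. by have := commuteDZ1 3; rewrite rotate4 rotate0. Qed.

Lemma involP n : P n * P n = 1. Proof. exact/involR/cross_square. Qed.
Lemma involQ n : Q n * Q n = 1. Proof. exact/involR/cross_square. Qed.
Lemma commutePa n : commute (P n) a. Proof. exact/commute_a_rotate/commute_cross_a. Qed.
Lemma commuteQa n : commute (Q n) a. Proof. exact/commute_a_rotate/commute_cross_a. Qed.
Lemma commutePZ n : commute (P n) (Z n).
Proof. exact/commute_rotate_both/commute_cross_z. Qed.
Lemma commutePW n : commute (P n) (W n.+1).
Proof. exact/(commute_shift (k := 1) n)/commute_cross_W. Qed.
Lemma commuteQW n : commute (Q n) (W n.+2).
Proof. exact/(commute_shift (k := 2) n)/commute_cross_W. Qed.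

Lemma commutePC0 n : commute (P n) (C n).
Proof. exact/commute_rotate_both/commute_cross_c. Qed.
Lemma commutePC1 n : commute (P n) (C n.+1).
Proof. apply/(commute_shift (k := 1) n)/commute_cross_C; exact: commuteCW0. Qed.
Lemma commutePC2 n : commute (P n) (C n.+2).
Proof. by apply/(commute_shift (k := 2) n)/commute_cross_C; have := commuteCW3 2; norm_index. Qed.
Lemma commutePD0 n : commute (P n) (D n).
Proof.
by apply/(commute_shift (k := 0) n)/commute_cross_D; have := commuteDZ0 0; rewrite !rotate0.
Qed.
Lemma commutePD1 n : commute (P n) (D n.+1).
Proof. exact/(commute_shift (k := 1) n)/commute_cross_Dj. Qed.
Lemma commutePD3 n : commute (P n) (D n.+3).
Proof. exact/(commute_shift (k := 3) n)/commute_cross_D/commute_D3z. Qed.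
Lemma commuteQC0 n : commute (Q n) (C n).
Proof. exact/commute_rotate_both/commute_cross_c. Qed.
Lemma commuteQC2 n : commute (Q n) (C n.+2).
Proof. apply/(commute_shift (k := 2) n)/commute_cross_C; exact: commuteCW0. Qed.
Lemma commuteQC3 n : commute (Q n) (C n.+3).
Proof. by apply/(commute_shift (k := 3) n)/commute_cross_C; have := commuteCW3 3; norm_index. Qed.
Lemma commuteQD0 n : commute (Q n) (D n).
Proof.
by apply/(commute_shift (k := 0) n)/commute_cross_D; have := commuteDZ0 0; rewrite !rotate0.
Qed.
Lemma commuteQD2 n : commute (Q n) (D n.+2).
Proof. exact/(commute_shift (k := 2) n)/commute_cross_Dj. Qed.
Lemma commuteQD3 n : commute (Q n) (D n.+3).
Proof. exact/(commute_shift (k := 3) n)/commute_cross_D/commute_D3z. Qed.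

Lemma P_y n : P n ^ y = P (3 * n + 3).
Proof. by rewrite rotate_y cross_y !rotateE -conjgM -expgnDr addnC. Qed.
Lemma Q_y n : Q n ^ y = Q (3 * n + 2).
Proof.
rewrite rotate_y cross_y (@rotate_eqmod _ (3 * 2) 2) // !rotateE -conjgM -expgnDr addnC //.
Qed.

Ltac facts_CD := index_facts involC; index_facts involD; pair_facts commuteCC;
  pair_facts commuteCD; pair_facts commuteDD.
Ltac facts_PQ := index_facts involP; index_facts involQ;
  offset_facts commutePC0; offset_facts commutePC1; offset_facts commutePC2;
  offset_facts commutePD0; offset_facts commutePD1; offset_facts commutePD3;
  offset_facts commuteQC0; offset_facts commuteQC2; offset_facts commuteQC3;
  offset_facts commuteQD0; offset_facts commuteQD2; offset_facts commuteQD3.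

Lemma zeta_rot : zeta ^ r = zeta.
Proof. by rewrite zetaE !(conjMg _ _ r) !rotateS rotate4; facts_CD; coxeter. Qed.
Lemma zeta_y : zeta ^ y = zeta.
Proof. by rewrite [in RHS]zetaD zetaE !(conjMg _ _ y) !rotate_y; norm_index; facts_CD; coxeter. Qed.
Lemma commuteCzeta i : commute (C i) zeta.
Proof. by rewrite zetaE; do 3!(apply: commuteM; last exact: commuteCC); exact: commuteCC. Qed.
Lemma zeta_square : zeta * zeta = 1.
Proof. by rewrite zetaE; facts_CD; coxeter. Qed.

(** zeta is fixed by the rotations. *)
Lemma conj_zeta_shift u g n : g ^ u = g ^ zeta -> rt g n ^ (u ^ (r ^+ n)) = rt g n ^ zeta.
Proof.
have zr : zeta ^ (r ^+ n) = zeta by apply/conj_commute/commuteX/commuteE/zeta_rot.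
by move/(congr1 (conjg^~ (r ^+ n))); rewrite /= (conjJg g u) (conjJg g zeta) zr -rotateE.
Qed.
(** Every letter of zeta except C (n + 3) commutes with P n; for D (n + 2) the same is
    seen from zeta as a word in the D. The elements Q are treated alike. *)
Lemma P_C n : P n ^ C n.+3 = P n ^ zeta.
Proof.
rewrite -(rotateD c 3 n); apply: conj_zeta_shift; rewrite -[cross 1]rotate0 zetaE.
by facts_CD; facts_PQ; coxeter.
Qed.
Lemma P_D n : P n ^ D n.+2 = P n ^ zeta.
Proof.
rewrite -(rotateD (c ^ y) 2 n); apply: conj_zeta_shift; rewrite -[cross 1]rotate0 zetaD.
by facts_CD; facts_PQ; coxeter.
Qed.
Lemma Q_C n : Q n ^ C n.+1 = Q n ^ zeta.
Proof.
rewrite -(rotateD c 1 n); apply: conj_zeta_shift; rewrite -[cross 2]rotate0 zetaE.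
by facts_CD; facts_PQ; coxeter.
Qed.
Lemma Q_D n : Q n ^ D n.+1 = Q n ^ zeta.
Proof.
rewrite -(rotateD (c ^ y) 1 n); apply: conj_zeta_shift; rewrite -[cross 2]rotate0 zetaD.
by facts_CD; facts_PQ; coxeter.
Qed.

Lemma rotate_rot u i j : rt (rt u i) j = rt u (i + j).
Proof. by rewrite (rotateE _ _ _ j) rotateD. Qed.

(** A cyclic shift, possible because eta commutes with W 0 and W 1. *)
Lemma etaW2 : eta = W 2 * W 3 * W 0 * W 1.
Proof.
rewrite -(conj_commute (commute_etaW 1)) -(conj_commute (commute_etaW 0)) etaW; facts_W; coxeter.
Qed.

(** Of the letters W of eta, only W (n + 1) and W (n + 2) fail to commute with C n. *)
Lemma eta_C n : eta ^ C n = Q n * eta * P n.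
Proof.
have E : eta ^ C 0 = Q 0 * eta * P 0.
  rewrite etaW2 !(conjMg _ _ (C 0)) (conj_W_C 1 0) (conj_W_C 2 0).
  have H3 : commute (C 0) (W 3) by have := commuteCW3 0; norm_index.
  rewrite (conj_commute (commute_sym (commuteCW0 0))) (conj_commute (commute_sym H3)).
  rewrite !rotate0 (commute_cross_W 1) -!mulgA; congr (_ * _).
have := congr1 (conjg^~ (r ^+ n)) E; rewrite /= conjJg !(conjMg _ _ (r ^+ n)) !rotateD.
by rewrite (conj_commute (commuteX n (commuteE eta_rot))).
Qed.
(** Inverting both sides of [eta_C], which are involutions. *)
Lemma eta_C' n : eta ^ C n = P n * eta * Q n.
Proof.
have H : eta ^ C n * eta ^ C n = 1 by apply: involJ; exact: eta2.
by rewrite -(involV H) eta_C; have ? := involP n; have ? := involQ n; have ? := eta2; coxeter.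
Qed.
(** The image of [eta_C] under y. *)
Lemma eta_D n : eta ^ D n = Q n.+2 * eta * P n.+3.
Proof.
have := congr1 (conjg^~ y) (eta_C 0); rewrite /= conjJg !(conjMg _ _ y) eta_y P_y Q_y.
rewrite rotate_y => /(congr1 (conjg^~ (r ^+ n))); rewrite /= conjJg !(conjMg _ _ (r ^+ n)) !rotateD.
by rewrite (conj_commute (commuteX n (commuteE eta_rot))).
Qed.
Lemma eta_D' n : eta ^ D n = P n.+3 * eta * Q n.+2.
Proof.
have H : eta ^ D n * eta ^ D n = 1 by apply: involJ; exact: eta2.
by rewrite -(involV H) eta_D; have ? := involP n.+3; have ? := involQ n.+2; have ? := eta2; coxeter.
Qed.

(** This is [commute_a_conj] for h = Z 0 * W j: here a ^ h also involves cross j. *)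
Lemma cross_factor j k : commute (D j * (C 0 * rt (cross j) 0))
  (rt c (3 * j + k) * (rt (c ^ y) (3 * 0 + k) * rt (cross j) (3 * j + k))).
Proof.
have ca : commute a (cross j) by apply/commute_sym/commute_cross_a.
have E : a ^ (Z 0 * W j) = a * (D j * (C 0 * rt (cross j) 0)).
  rewrite conj_aZW !rotate0 crossE; congr (_ * (_ * _)).
  by have ? := c2; have ? := involW j; coxeter.
have := commute_a_factor k E; rewrite (conjMg (D j)) (conjMg (C 0)) rotate_yyr rotate_yr.
rewrite (rotate_yr (cross j)) cross_y rotate_rot; apply.
rewrite [rt (cross j) 0]rotate0.
by apply: commuteM; [exact: commute_aD|apply: commuteM => //; exact: commute_aC].
Qed.

Lemma commuteP02 : commute (P 0) (P 2).
Proof.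
have H := cross_factor 1 3; move: H; norm_index => H; facts_CD; facts_PQ.
by coxeter_by H (D 1 * C 0 * C 2 * D 3) (1 : G).
Qed.
Lemma commuteQ02 : commute (Q 0) (Q 2).
Proof.
have H := cross_factor 2 0; move: H; norm_index => H; facts_CD; facts_PQ.
by coxeter_by H (D 2 * C 0 * C 2 * D 0) (1 : G).
Qed.

Lemma commute_orbit u : commute u (rt u 1) -> commute u (rt u 2) ->
  forall i j, commute (rt u i) (rt u j).
Proof.
move=> u1 u2; apply: commute_rotates => j; rewrite rotate_mod.
have : (j %% 4 < 4)%N by rewrite ltn_mod.
case: (j %% 4) => [|[|[|[|//]]]] _ //; first by rewrite rotate0.
by have := commute_shift 3 u1; rewrite -[(1 + 3)%N]/4 rotate4 rotate0 => /commute_sym.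
Qed.

(** C 0 and D k commute; the two orders in which they act on eta give two expressions.
    The cases k = 0 and 3 make the P commute with each other, and the Q; the cases k =
    2 and 1 make the commutators with zeta independent of the rotation. *)
Lemma eta_CD k : Q 0 ^ D k * (Q k.+2 * eta * P k.+3) * P 0 ^ D k =
  Q k.+2 ^ C 0 * (Q 0 * eta * P 0) * P k.+3 ^ C 0.
Proof.
have := congr1 (conjg eta) (commuteCD 0 k); rewrite /= !conjgM eta_C eta_D.
rewrite (conjMg (Q 0 * eta)) (conjMg (Q 0)) eta_D.
by rewrite (conjMg (Q k.+2 * eta)) (conjMg (Q k.+2)) eta_C.
Qed.

Lemma commutePP i j : commute (P i) (P j).
Proof.
have P30 : commute (P 3) (P 0).
  have H := eta_CD 0; facts_CD; facts_PQ; have ? := commuteQ02; have ? := eta2.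
  by coxeter_by H (eta * Q 2 * Q 0) (1 : G).
apply: commute_orbit; last by rewrite -[cross 1]rotate0 rotate_rot; exact: commuteP02.
by have := commute_rotate 1 P30; rewrite addn1 rotate4 rotate0.
Qed.
Lemma commuteQQ i j : commute (Q i) (Q j).
Proof.
have Q01 : commute (Q 0) (Q 1).
  have := eta_CD 3; norm_index => H; facts_CD; facts_PQ; have ? := commuteP02; have ? := eta2.
  by coxeter_by H (1 : G) (P 0 * P 2 * eta).
apply: commute_orbit; rewrite -[cross 2]rotate0 rotate_rot //; exact: commuteQ02.
Qed.

Lemma theta1_step : P 1 * P 1 ^ zeta = P 0 * P 0 ^ zeta.
Proof.
have H : P 1 * P 0 ^ zeta = P 0 * P 1 ^ zeta.
  have := eta_CD 2; norm_index; have := P_C 1; rewrite (rotate4 c 0) => ->.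
  rewrite (P_D 0) => H; facts_CD; facts_PQ; have ? := zeta_square; have ? := eta2.
  by coxeter_by H (eta : G) (1 : G).
have ? := zeta_square; have ? := commutePP 0 1; facts_PQ.
by symmetry; coxeter_by H (P 0 * P 1) (1 : G).
Qed.
Lemma theta2_step : Q 3 * Q 3 ^ zeta = Q 0 * Q 0 ^ zeta.
Proof.
have H : Q 3 * Q 0 ^ zeta = Q 0 * Q 3 ^ zeta.
  have := eta_CD 1; norm_index; have := Q_C 3; rewrite (rotate4 c 0) => ->.
  rewrite (Q_D 0) => /(congr1 (@monoid.inv G)) H; facts_CD; facts_PQ.
  have ? := zeta_square; have ? := eta2.
  by coxeter_by H (eta : G) (1 : G).
have ? := zeta_square; have ? := commuteQQ 0 3; facts_PQ.
by symmetry; coxeter_by H (Q 0 * Q 3) (1 : G).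
Qed.

(** * The commutators of P and Q with zeta *)

Lemma rotate_theta j n : rt (theta j) n = rt (cross j) n * rt (cross j) n ^ zeta.
Proof.
rewrite thetaE rotateM [rt (_ ^ _) n]rotateE conjJg -rotateE.
by rewrite (conj_commute (commuteX n (commuteE zeta_rot))).
Qed.
Lemma theta1_rot : theta 1 ^ r = theta 1.
Proof.
by have := rotate_theta 1 1; rewrite theta1_step rotateE expg1 !rotate0 -thetaE.
Qed.
Lemma theta2_rot : theta 2 ^ r = theta 2.
Proof.
have E : rt (theta 2) 3 = theta 2 by rewrite rotate_theta theta2_step rotate0 -thetaE.
by rewrite -{1}E rotateS rotate4 rotate0.
Qed.
Lemma theta1P n : theta 1 = P n * P n ^ zeta.
Proof. by rewrite -rotate_theta rotateE (conj_commute (commuteX n (commuteE theta1_rot))). Qed.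
Lemma theta2Q n : theta 2 = Q n * Q n ^ zeta.
Proof. by rewrite -rotate_theta rotateE (conj_commute (commuteX n (commuteE theta2_rot))). Qed.
Lemma theta1_y : theta 1 ^ y = theta 1.
Proof. by rewrite {1}thetaE (conjMg (cross 1)) conjJg cross_y zeta_y -theta1P. Qed.
Lemma theta2_y : theta 2 ^ y = theta 2.
Proof.
by rewrite {1}thetaE (conjMg (cross 2)) conjJg cross_y zeta_y -theta2Q.
Qed.
Lemma commute_theta1C i : commute (theta 1) (C i).
Proof.
apply: commute_sym; have h := commute_sym (commutePC0 i).
by rewrite (theta1P i); apply: commuteM => //; apply: commute_conj => //; exact: commuteCzeta.
Qed.
Lemma commute_theta2C i : commute (theta 2) (C i).
Proof.
apply: commute_sym; have h := commute_sym (commuteQC0 i).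
by rewrite (theta2Q i); apply: commuteM => //; apply: commute_conj => //; exact: commuteCzeta.
Qed.
Lemma commute_azeta : commute a zeta.
Proof. by rewrite zetaE; do 3!(apply: commuteM; last exact: commute_aC); exact: commute_aC. Qed.
Lemma commute_atheta j : commute a (theta j).
Proof.
have ac := commute_sym (commute_cross_a j).
by rewrite thetaE; apply: commuteM => //; apply: commute_conj => //; exact: commute_azeta.
Qed.
Lemma commute_theta_zeta1 : commute (theta 1) zeta.
Proof.
by rewrite zetaE; do 3!(apply: commuteM; last exact: commute_theta1C); exact: commute_theta1C.
Qed.
Lemma commute_theta_zeta2 : commute (theta 2) zeta.
Proof.
by rewrite zetaE; do 3!(apply: commuteM; last exact: commute_theta2C); exact: commute_theta2C.
Qed.

(** Conjugation by u or by w inverts u * u ^ w; so if it commutes with w, its square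
    is 1. *)
Lemma square_commute_invol u w : u * u = 1 -> w * w = 1 -> commute (u * u ^ w) w ->
  commute (u * u ^ w) u /\ u * u ^ w * (u * u ^ w) = 1.
Proof.
move=> u2 w2 H; split; first by coxeter_by H (1 : G) (w * u).
by coxeter_by H (1 : G) (w * u * w * u * w).
Qed.
Lemma theta1_facts n : [/\ commute (theta 1) (P n), theta 1 * theta 1 = 1 &
  P n ^ zeta = theta 1 * P n].
Proof.
have H : commute (P n * P n ^ zeta) zeta by rewrite -theta1P; exact: commute_theta_zeta1.
have [] := square_commute_invol (involP n) zeta_square H; rewrite -theta1P => H1 H2; split=> //.
by rewrite H1 (theta1P n) mulgA involP mul1g.
Qed.
Lemma theta2_facts n : [/\ commute (theta 2) (Q n), theta 2 * theta 2 = 1 &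
  Q n ^ zeta = theta 2 * Q n].
Proof.
have H : commute (Q n * Q n ^ zeta) zeta by rewrite -theta2Q; exact: commute_theta_zeta2.
have [] := square_commute_invol (involQ n) zeta_square H; rewrite -theta2Q => H1 H2; split=> //.
by rewrite H1 (theta2Q n) mulgA involQ mul1g.
Qed.

Lemma conj_D_Z0 j : D j ^ Z 0 = cross j * D j.
Proof.
have H : Z 0 ^ D j = cross j * Z 0 by have := conj_Z_D j 0; rewrite addn0 (rotate0 (cross j)).
have ? := involZ 0; have ? := involD j; have ? := cross_square j.
have ? : commute (cross j) (Z 0) by rewrite rotate0; exact: commute_cross_z.
by coxeter_by H (Z 0) (D j).
Qed.
Lemma conj_C_W j n : C n ^ W (j + n) = rt (cross j) n * C n.
Proof.
have H := conj_W_C j n; have ? := involC n; have ? := involW (j + n).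
have ? := involR n (cross_square j); have ? := commute_shift n (commute_cross_W j).
by coxeter_by H (W (j + n)) (C n).
Qed.

(** Z 0 moves only the letters D 1 and D 2 of zeta. These commute, which gives both
    orders. *)
Lemma conj_zeta_Z : zeta ^ Z 0 = P 0 * zeta * Q 0 /\ zeta ^ Z 0 = Q 0 * zeta * P 0.
Proof.
have D0 : commute (D 0) (Z 0) by exact: commuteDZ0.
have D3 : commute (D 3) (Z 0) by have := commuteDZ1 3; rewrite rotate4.
have H1 : D 1 ^ Z 0 = P 0 * D 1 by rewrite conj_D_Z0 (rotate0 (cross 1)).
have H2 : D 2 ^ Z 0 = Q 0 * D 2 by rewrite conj_D_Z0 (rotate0 (cross 2)).
have E : zeta ^ Z 0 = D 0 * (P 0 * D 1) * (Q 0 * D 2) * D 3.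
  by rewrite zetaD !(conjMg _ _ (Z 0)) H1 H2 (conj_commute D0) (conj_commute D3).
have E' : zeta ^ Z 0 = D 0 * (Q 0 * D 2) * (P 0 * D 1) * D 3.
  have -> : zeta = D 0 * D 2 * D 1 * D 3.
    by rewrite zetaD; clear D0 D3 H1 H2 E; facts_CD; coxeter.
  by rewrite !(conjMg _ _ (Z 0)) H1 H2 (conj_commute D0) (conj_commute D3).
split; [rewrite E|rewrite E']; rewrite zetaD; clear D0 D3 H1 H2 E E'; facts_CD; facts_PQ; coxeter.
Qed.
(** W 1 moves only the letters C 0 and C 3 of zeta. *)
Lemma conj_zeta_W : zeta ^ W 1 = P 0 * zeta * Q 3 /\ zeta ^ W 1 = Q 3 * zeta * P 0.
Proof.
have CW2 : commute (C 2) (W 1) by have := commuteCW3 2; norm_index.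
have CW1 := commuteCW0 1.
have H0 : C 0 ^ W 1 = P 0 * C 0 := conj_C_W 1 0.
have H3 : C 3 ^ W 1 = Q 3 * C 3 by rewrite -(conj_C_W 2 3) (rotate4 (z ^ y) 1).
have E : zeta ^ W 1 = Q 3 * C 3 * C 2 * C 1 * (P 0 * C 0).
  by rewrite zetaE !(conjMg _ _ (W 1)) H0 H3 (conj_commute CW1) (conj_commute CW2).
have E' : zeta ^ W 1 = P 0 * C 0 * C 2 * C 1 * (Q 3 * C 3).
  have -> : zeta = C 0 * C 2 * C 1 * C 3.
    by rewrite zetaE; clear CW1 CW2 H0 H3 E; facts_CD; coxeter.
  by rewrite !(conjMg _ _ (W 1)) H0 H3 (conj_commute CW1) (conj_commute CW2).
split; [rewrite E'|rewrite E]; rewrite zetaE; clear H0 H3 E E' CW1 CW2; facts_CD; facts_PQ; coxeter.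
Qed.

(** The two expressions of [conj_zeta_Z] agree; carrying zeta to the left turns P 0
    and Q 0 into theta 1 * P 0 and theta 2 * Q 0. *)
Lemma theta12_Q0 : theta 1 * theta 2 = P 0 * Q 0 * P 0 * Q 0.
Proof.
have [E1 E2] := conj_zeta_Z; have H : P 0 * zeta * Q 0 = Q 0 * zeta * P 0 by rewrite -E1.
have H' : P 0 ^ zeta * Q 0 = Q 0 ^ zeta * P 0.
  by clear E1 E2; have ? := zeta_square; facts_PQ; coxeter_by H (zeta : G) (1 : G).
have [p1 t1 zp] := theta1_facts 0; have [q2 t2 zq] := theta2_facts 0.
move: H'; rewrite zp zq => /(congr1 (@monoid.inv G)) {E1 E2 H zp zq} H; facts_PQ.
by coxeter_by H (P 0 * Q 0) (theta 2).
Qed.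
Lemma theta12_Q3 : theta 1 * theta 2 = P 0 * Q 3 * P 0 * Q 3.
Proof.
have [E1 E2] := conj_zeta_W; have H : P 0 * zeta * Q 3 = Q 3 * zeta * P 0 by rewrite -E1.
have H' : P 0 ^ zeta * Q 3 = Q 3 ^ zeta * P 0.
  by clear E1 E2; have ? := zeta_square; facts_PQ; coxeter_by H (zeta : G) (1 : G).
have [p1 t1 zp] := theta1_facts 0; have [q2 t2 zq] := theta2_facts 3.
move: H'; rewrite zp zq => /(congr1 (@monoid.inv G)) {E1 E2 H zp zq} H; facts_PQ.
by coxeter_by H (P 0 * Q 3) (theta 2).
Qed.
Lemma commuteP0_Q03 : commute (P 0) (Q 0 * Q 3).
Proof.
have H := theta12_Q0; rewrite theta12_Q3 in H; have ? := commuteQQ 0 3; facts_PQ.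
by move/esym: H => H; coxeter_by H (Q 0 * P 0) (Q 3).
Qed.
(** Conjugation by C 1 fixes P 0 and Q 3 and multiplies Q 0 by theta 2, so
    [commuteP0_Q03] holds with and without the factor theta 2. *)
Lemma commute_theta2P n : commute (theta 2) (P n).
Proof.
have H : commute (P 0) (theta 2).
  have := commuteJ (C 1) commuteP0_Q03; rewrite (conjMg (Q 0)) (Q_C 0).
  have [_ _ ->] := theta2_facts 0.
  have q3 : commute (Q 3) (C 1) by have := commuteQC2 3; norm_index.
  rewrite (conj_commute q3) (conj_commute (commutePC1 0)) -mulgA => H.
  exact: commuteMKl H commuteP0_Q03.
have := commuteJ (r ^+ n) (commute_sym H); rewrite rotateD.
by rewrite (conj_commute (commuteX n (commuteE theta2_rot))).
Qed.
Lemma commute_theta12 : commute (theta 1) (theta 2).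
Proof.
apply/commute_sym; have h := commute_theta2P 0; rewrite (theta1P 0).
by apply: commuteM => //; apply: commute_conj => //; exact: commute_theta_zeta2.
Qed.
(** Q 0 inverts (P 0 * Q 0) ^ 2 = theta 1 * theta 2, which is an involution. *)
Lemma commute_theta1Q n : commute (theta 1) (Q n).
Proof.
have [p1 t1 zp] := theta1_facts 0; have [q2 t2 zq] := theta2_facts 0.
have E := theta12_Q0; have E' := esym (congr1 (@monoid.inv G) E).
have t12 := commute_theta12.
have H : commute (Q 0) (theta 1 * theta 2).
  transitivity (Q 0 * P 0 * Q 0 * P 0 * Q 0); clear zp zq; have ? := involP 0; have ? := involQ 0.
    by clear E'; coxeter_by E (Q 0) (1 : G).
  by clear E; coxeter_by E' (1 : G) (Q 0).
have H1 := commuteMKl H (commute_sym q2).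
have := commuteJ (r ^+ n) (commute_sym H1); rewrite rotateD.
by rewrite (conj_commute (commuteX n (commuteE theta1_rot))).
Qed.
(** Conjugation by Z 0 fixes P 0 and turns its commutator with zeta into the one with
    P 0 * zeta * Q 0. *)
Lemma theta1_Z : theta 1 ^ Z 0 = theta 2.
Proof.
have [p1 t1 zp] := theta1_facts 0; have [q2 t2 zq] := theta2_facts 0.
rewrite (theta1P 0) (conjMg (P 0)) (conjJg (P 0)) (conj_commute (commutePZ 0)) (proj1 conj_zeta_Z).
rewrite !(conjgM (P 0)) (conj_commute (commute_refl (P 0))) zp.
have E := esym theta12_Q0; have ? := commute_theta1Q 0; have ? := involP 0; have ? := involQ 0.
by clear zp zq; coxeter_by E (theta 1) (1 : G).
Qed.
Lemma theta2_Z : theta 2 ^ Z 0 = theta 1.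
Proof. by rewrite -theta1_Z -conjgM involZ conjg1. Qed.

Lemma theta12_central g : commute (theta 1 * theta 2) g.
Proof.
apply: central_of g.
- exact/commute_sym/commuteM/commute_atheta/commute_atheta.
- by apply: commuteE; rewrite (conjMg (theta 1)) theta1_rot theta2_rot.
- by apply: commuteE; rewrite (conjMg (theta 1)) theta1_y theta2_y.
- have h : commute (theta 1 * theta 2) (Z 0).
    by apply: commuteE; rewrite (conjMg (theta 1)) theta1_Z theta2_Z commute_theta12.
  by rewrite rotate0 in h.
Qed.
Lemma theta12_square : theta 1 * theta 2 * (theta 1 * theta 2) = 1.
Proof.
have [_ ? _] := theta1_facts 0; have [_ ? _] := theta2_facts 0; have ? := commute_theta12.
by coxeter.
Qed.

Hypothesis theta12 : theta 1 * theta 2 = 1.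

Lemma theta_eq : theta 2 = theta 1.
Proof.
have [_ t1 _] := theta1_facts 0; have [_ t2 _] := theta2_facts 0.
by rewrite -[LHS]mul1g -theta12 -mulgA t2 mulg1.
Qed.
Lemma theta_central g : commute (theta 1) g.
Proof.
apply: central_of g.
- exact/commute_sym/commute_atheta.
- exact/commuteE/theta1_rot.
- exact/commuteE/theta1_y.
- have h : commute (theta 1) (Z 0) by apply: commuteE; rewrite theta1_Z theta_eq.
  by rewrite rotate0 in h.
Qed.
Lemma theta_square : theta 1 * theta 1 = 1.
Proof. by have [] := theta1_facts 0. Qed.

Hypothesis theta1_1 : theta 1 = 1.
Lemma commutePzeta n : commute (P n) zeta.
Proof. by apply: commuteE; have [_ _ ->] := theta1_facts n; rewrite theta1_1 mul1g. Qed.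
Lemma commutePD2 n : commute (P n) (D n.+2).
Proof. by apply: commuteE; rewrite P_D (conj_commute (commutePzeta n)). Qed.
Lemma commutePD i j : commute (P i) (D j).
Proof.
move: i j; apply: commute_offsets => i;
 [exact: commutePD0|exact: commutePD1|exact: commutePD2|exact: commutePD3].
Qed.

(** * The commutators of P and Q with eta *)

Lemma commutePQ0 n : commute (P n) (Q n).
Proof.
have H := theta12_Q0; rewrite theta12 in H; have ? := involP 0; have ? := involQ 0.
have PQ : commute (P 0) (Q 0) by move/esym: H => H; coxeter_by H (1 : G) (Q 0 * P 0).
by have := commute_rotate n PQ; rewrite !add0n.
Qed.
Lemma commutePQ3 n : commute (P n) (Q n.+3).
Proof.
have H := theta12_Q3; rewrite theta12 in H; have ? := involP 0; have ? := involQ 3.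
have PQ : commute (P 0) (Q 3) by move/esym: H => H; coxeter_by H (1 : G) (Q 3 * P 0).
by have := commute_rotate n PQ; rewrite add0n add3n.
Qed.
Lemma commute_eta_PQ0 : commute eta (P 0 * Q 0).
Proof.
have H : Q 0 * eta * P 0 = P 0 * eta * Q 0 by rewrite -eta_C eta_C'.
have ? := commutePQ0 0; have ? := involP 0; have ? := involQ 0; have ? := eta2.
by coxeter_by H (Q 0) (Q 0).
Qed.
Lemma commute_eta_PQ3 : commute eta (P 0 * Q 3).
Proof.
have H : Q 3 * eta * P 4 = P 4 * eta * Q 3 by rewrite -eta_D eta_D'.
rewrite rotate4 in H.
have ? := commutePQ3 0; have ? := involP 0; have ? := involQ 3; have ? := eta2.
by coxeter_by H (Q 3) (Q 3).
Qed.

(** Because eta commutes with P 0 * Q 0. *)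
Lemma delta0 : P 0 * P 0 ^ eta = Q 0 * Q 0 ^ eta.
Proof.
have H := commute_eta_PQ0.
have ? := commutePQ0 0; have ? := involP 0; have ? := involQ 0; have ? := eta2.
by coxeter_by H (P 0 : G) (Q 0 * eta).
Qed.
Lemma delta3 : P 0 * P 0 ^ eta = Q 3 * Q 3 ^ eta.
Proof.
have H := commute_eta_PQ3.
have ? := commutePQ3 0; have ? := involP 0; have ? := involQ 3; have ? := eta2.
by coxeter_by H (P 0 : G) (Q 3 * eta).
Qed.
Lemma eta_rotX n : eta ^ (r ^+ n) = eta.
Proof. exact/conj_commute/commuteX/commuteE/eta_rot. Qed.
Lemma delta_rot : (P 0 * P 0 ^ eta) ^ r = P 0 * P 0 ^ eta.
Proof.
rewrite delta3 (conjMg (Q 3)) (conjJg (Q 3)) eta_rot rotateS rotate4 -delta3.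
exact/esym/delta0.
Qed.
Lemma deltaP n : P 0 * P 0 ^ eta = P n * P n ^ eta.
Proof.
rewrite -[LHS](conj_commute (commuteX n (commuteE delta_rot))) (conjMg (P 0)) (conjJg (P 0)).
by rewrite eta_rotX rotateD add0n.
Qed.
Lemma conj_shift u v n : u ^ v = u ^ eta -> rt u n ^ (v ^ (r ^+ n)) = rt u n ^ eta.
Proof.
by move/(congr1 (conjg^~ (r ^+ n))); rewrite /= (conjJg u v) (conjJg u eta) eta_rotX -rotateE.
Qed.

(** The relation arises from the commutation of eta and w by a conjugation that takes
    w to v * w and eta to u * eta * v = v * eta * u. *)
Lemma eta_conj_transfer u v w : u * u = 1 -> v * v = 1 -> w * w = 1 ->
  commute v w -> commute eta w ->
  u * eta * v * (v * w) = (v * w) * (v * eta * u) -> u ^ w = u ^ eta.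
Proof.
move=> u2 v2 w2 vw ew H; have ? := eta2.
by coxeter_by H w (eta : G).
Qed.
Lemma P0_W2 : P 0 ^ W 2 = P 0 ^ eta.
Proof.
apply: eta_conj_transfer (involP 0) (involQ 0) (involW 2) (commuteQW 0) (commute_etaW 2) _.
rewrite -eta_C' -eta_C -(conj_W_C 2 0); exact: commuteJ (commute_etaW 2).
Qed.
Lemma Q0_W1 : Q 0 ^ W 1 = Q 0 ^ eta.
Proof.
apply: eta_conj_transfer (involQ 0) (involP 0) (involW 1) (commutePW 0) (commute_etaW 1) _.
rewrite -eta_C' -eta_C -(conj_W_C 1 0); exact: commuteJ (commute_etaW 1).
Qed.
Lemma P_W n : P n ^ W n.+2 = P n ^ eta.
Proof. by have := conj_shift n P0_W2; rewrite rotateD rotate_rot. Qed.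
Lemma Q_W n : Q n ^ W n.+1 = Q n ^ eta.
Proof. by have := conj_shift n Q0_W1; rewrite rotateD rotate_rot. Qed.
Lemma commute_invariant u v k : u ^ r = u -> commute u (rt v k) ->
  forall n, commute u (rt v n).
Proof.
move=> ur uv n; have -> : rt v n = rt v (k + (n + 3 * k)).
  by apply: rotate_eqmod; rewrite addnCA -mulSn addnC mulnC modnMDl.
have := commute_shift (n + 3 * k) uv; rewrite (rotateE x y u).
by rewrite (conj_commute (commuteX _ (commuteE ur))).
Qed.
(** P 1 commutes with P 0 and W 2, hence with P 0 ^ W 2 = P 0 ^ eta. *)
Lemma commute_deltaP n : commute (P 0 * P 0 ^ eta) (P n).
Proof.
have H : commute (P 0 * P 0 ^ eta) (P 1).
  apply/commute_sym/commuteM; first exact: commutePP.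
  by rewrite -P0_W2; apply: commute_conj; [exact: commutePP|exact: commutePW].
exact: commute_invariant delta_rot H n.
Qed.
Lemma delta_y : (P 0 * P 0 ^ eta) ^ y = P 0 * P 0 ^ eta.
Proof. by rewrite (conjMg (P 0)) (conjJg (P 0)) eta_y P_y -deltaP. Qed.
Lemma commuteP_eta : commute (P 0) (P 0 ^ eta).
Proof. exact: commuteMK (commute_sym (commute_deltaP 0)) (commute_refl _). Qed.
Lemma delta_square : P 0 * P 0 ^ eta * (P 0 * P 0 ^ eta) = 1.
Proof.
by have := commuteP_eta => H; have ? := involJ eta (involP 0); have ? := involP 0; coxeter.
Qed.
(** W 2 exchanges P 0 and P 0 ^ eta, which commute. *)
Lemma commute_deltaW n : commute (P 0 * P 0 ^ eta) (W n).
Proof.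
apply: (commute_invariant (k := 2)) delta_rot _ n; apply: commuteE.
rewrite -{1}P0_W2 (conjMg (P 0)) -(conjgM (P 0)) involW conjg1 P0_W2.
exact/esym/commuteP_eta.
Qed.
Lemma conj_W_a n : W n ^ a = W n * D n.
Proof.
have -> : D n = W n * W n ^ a.
  rewrite rotate_a -rotateM cE; congr (rotate _ _ _ _).
  by rewrite conjMg -!conjgM (setup_ay S).
by rewrite mulgA involW mul1g.
Qed.
(** Conjugation by a changes W n by D n, which commutes with W n and with u. *)
Lemma commute_conjW_a u n : commute u a -> commute u (D n) -> commute (u ^ W n) a.
Proof.
move=> ua uD; apply: commuteE; rewrite conjJg (conj_commute ua) conj_W_a (conjgM u).
by apply/conj_commute/commute_conjl => //; exact: commuteDW.
Qed.
Lemma delta_central g : commute (P 0 * P 0 ^ eta) g.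
Proof.
apply: central_of g.
- apply: commuteMl; first exact: commutePa.
  rewrite -P0_W2; apply: commute_conjW_a; [exact: commutePa|exact: commutePD].
- exact/commuteE/delta_rot.
- exact/commuteE/delta_y.
- apply: (commuteJK (g := y)); rewrite delta_y -[z ^ y]rotate0; exact: commute_deltaW.
Qed.

(** * The commutators of P with W *)

Hypothesis delta1 : P 0 * P 0 ^ eta = 1.
Lemma commuteP_etan n : commute (P n) eta.
Proof.
have H : commute eta (P 0).
  have ? := involP 0; have ? := eta2.
  by apply/commute_sym; coxeter_by delta1 (1 : G) (eta * P 0).
by apply/commute_sym; exact: commute_invariant eta_rot H n.
Qed.
Lemma commuteQ_etan n : commute (Q n) eta.
Proof.
have H : commute eta (Q 0).
  have ? := involQ 0; have ? := eta2; have H := delta1; rewrite delta0 in H; clear delta1.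
  by apply/commute_sym; coxeter_by H (1 : G) (eta * Q 0).
by apply/commute_sym; exact: commute_invariant eta_rot H n.
Qed.
Lemma commutePW2 n : commute (P n) (W n.+2).
Proof. by apply: commuteE; rewrite P_W (conj_commute (commuteP_etan n)). Qed.
Lemma commuteQW1 n : commute (Q n) (W n.+1).
Proof. by apply: commuteE; rewrite Q_W (conj_commute (commuteQ_etan n)). Qed.

Lemma commuteP_W30 : commute (P 0) (W 3 * W 0).
Proof.
have E : eta = W 1 * W 2 * (W 3 * W 0).
  by rewrite -(conj_commute (commute_etaW 0)) etaW; facts_W; coxeter.
have := commuteP_etan 0; rewrite E => /commuteMK; apply.
by apply: commuteM; [exact: commutePW|exact: commutePW2].
Qed.
Lemma commuteQ_W30 : commute (Q 0) (W 3 * W 0).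
Proof.
have E : eta = W 1 * W 2 * (W 3 * W 0).
  by rewrite -(conj_commute (commute_etaW 0)) etaW; facts_W; coxeter.
have := commuteQ_etan 0; rewrite E => /commuteMK; apply.
by apply: commuteM; [exact: commuteQW1|exact: commuteQW].
Qed.
Lemma P_W30 : P 0 ^ W 3 = P 0 ^ W 0.
Proof.
by rewrite -[in RHS](conj_commute commuteP_W30) -(conjgM (P 0)) (involK (involW 0)).
Qed.
(** C 0 fixes W 0 and takes eta to eta * (Q 0 * P 0), and eta commutes with W 0. *)
Lemma commutePQ_W0 : commute (Q 0 * P 0) (W 0).
Proof.
have := commuteJ (C 0) (commute_etaW 0).
rewrite (conj_commute (commute_sym (commuteCW0 0))) eta_C (commuteQ_etan 0) -mulgA => H.
exact/commute_sym/(commuteMK (commute_sym H))/commute_sym/commute_etaW.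
Qed.
Lemma omegaQ : P 0 * P 0 ^ W 0 = Q 0 * Q 0 ^ W 0.
Proof.
have H := commutePQ_W0; have ? := commutePQ0 0; have ? := involP 0; have ? := involQ 0.
have ? := involW 0; by coxeter_by H (Q 0 : G) (P 0 * W 0).
Qed.

(** The conjugate z ^ (D 1) of z is z times P 0. *)
Lemma sandwich_ZP i : commute (Z 0 * P 0) ((Z 0 * P 0) ^ (y * r ^+ i)).
Proof.
have -> : Z 0 * P 0 = z ^ D 1 by rewrite -(commutePZ 0) -(conj_Z_D 1 0) (rotate0 z).
have [s [g [is_ ->]]] := refl_conj i; apply: sandwich_conj => //.
by move: is_; rewrite !inE => /orP [] ->; rewrite !orbT.
Qed.
(** The relation [sandwich_ZP] for the reflection x; below, for y. *)
Lemma omega_P2 : P 2 * P 2 ^ Z 0 = P 0 ^ W 0 * P 0.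
Proof.
have := sandwich_ZP 3; rewrite (conjMg (Z 0)) rotate_yr (rotate_yr (cross 1)) cross_y rotate_rot.
norm_index; rewrite -P_W30 => H.
have ? := commuteZW 0 3; have ? := commutePP 0 2; have ? := commutePZ 0.
have ? := commutePW 2; have ? := involP 0; have ? := involP 2; facts_Z; facts_W.
by move/esym: H => H; coxeter_by H (W 3) (P 0 * P 2 * Z 0).
Qed.
Lemma omega_P3 : P 3 * P 3 ^ Z 0 = P 0 ^ W 0 * P 0.
Proof.
have := sandwich_ZP 0; rewrite (conjMg (Z 0)) rotate_yr (rotate_yr (cross 1)) cross_y rotate_rot.
norm_index => H; have P3W0 : commute (P 3) (W 0) by have := commutePW 3; rewrite rotate4.
have ? := commuteZW 0 0; have ? := commutePP 0 3; have ? := commutePZ 0.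
have ? := involP 0; have ? := involP 3; facts_Z; facts_W.
by move/esym: H => H; coxeter_by H (W 0) (P 0 * P 3 * Z 0).
Qed.
Lemma omegaV : (P 0 * P 0 ^ W 0)^-1 = P 0 ^ W 0 * P 0.
Proof. by have ? := involP 0; have ? := involW 0; coxeter. Qed.
Lemma omega_y : (P 0 * P 0 ^ W 0) ^ y = (P 0 * P 0 ^ W 0)^-1.
Proof.
have := congr1 (conjg^~ y) omega_P3.
rewrite /= -omegaV conjVg (conjMg (P 3)) (conjJg (P 3)) P_y rotate_y; norm_index => E.
by rewrite [in RHS]E invgK.
Qed.
(** Conjugated by y, the left sides of [omega_P2] and [omega_P3] are the elements
    omega for P 1 and P 0. *)
Lemma omega_rot : (P 0 * P 0 ^ W 0) ^ r = P 0 * P 0 ^ W 0.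
Proof.
have := congr1 (conjg^~ y) omega_P2.
rewrite /= -omegaV conjVg omega_y invgK (conjMg (P 2)) (conjJg (P 2)) P_y rotate_y; norm_index => E.
by rewrite -[RHS]E (conjMg (P 0)) -P_W30 (conjJg (P 0)) !rotateS rotate4.
Qed.
(** P 2 commutes with P 0 and with W 0. *)
Lemma commute_omegaP n : commute (P 0 * P 0 ^ W 0) (P n).
Proof.
have P2W0 : commute (P 2) (W 0) by have := commutePW2 2; rewrite rotate4.
have H : commute (P 0 * P 0 ^ W 0) (P 2).
  apply: commuteMl; first exact: commutePP.
  by apply: commute_conjl; [exact: commutePP|exact: commute_sym].
exact: commute_invariant omega_rot H n.
Qed.
Lemma commuteP_PW : commute (P 0) (P 0 ^ W 0).
Proof. exact: commuteMK (commute_sym (commute_omegaP 0)) (commute_refl _). Qed.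
Lemma omega_square : P 0 * P 0 ^ W 0 * (P 0 * P 0 ^ W 0) = 1.
Proof.
by have := commuteP_PW => H; have ? := involJ (W 0) (involP 0); have ? := involP 0; coxeter.
Qed.
Lemma omega_central g : commute (P 0 * P 0 ^ W 0) g.
Proof.
have wy : (P 0 * P 0 ^ W 0) ^ y = P 0 * P 0 ^ W 0 by rewrite omega_y (involV omega_square).
apply: central_of g.
- apply: commuteMl; first exact: commutePa.
  by apply: commute_conjW_a; [exact: commutePa|exact: commutePD].
- exact/commuteE/omega_rot.
- exact/commuteE/wy.
- apply: (commuteJK (g := y)); rewrite wy -{2}(rotate0 (z ^ y)); apply: commuteE.
  rewrite (conjMg (P 0)) -(conjgM (P 0)) involW conjg1; exact/esym/commuteP_PW.
Qed.

(** * The normal subgroup generated by the P and Q *)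

Hypothesis omega1 : P 0 * P 0 ^ W 0 = 1.
(** P 0 commutes with W 0 since omega = 1, and with W 3 since it commutes with W 3 * W
    0. *)
Lemma commutePW_all i j : commute (P i) (W j).
Proof.
have ? := involP 0; have ? := involW 0.
have P00 : commute (P 0) (W 0) by coxeter_by omega1 (1 : G) (W 0 * P 0).
have P03 : commute (P 0) (W 3) by apply: commuteMKl commuteP_W30 P00.
move: i j; apply: commute_offsets => i.
- by have := commute_rotate i P00; rewrite !add0n.
- exact: commutePW.
- exact: commutePW2.
- by have := commute_rotate i P03; rewrite add0n add3n.
Qed.
Lemma commuteQW_all i j : commute (Q i) (W j).
Proof.
have ? := involQ 0; have ? := involW 0; have H := omegaQ; rewrite omega1 in H.
have Q00 : commute (Q 0) (W 0) by move/esym: H => H; coxeter_by H (1 : G) (W 0 * Q 0).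
have Q03 : commute (Q 0) (W 3) by apply: commuteMKl commuteQ_W30 Q00.
move: i j; apply: commute_offsets => i.
- by have := commute_rotate i Q00; rewrite !add0n.
- exact: commuteQW1.
- exact: commuteQW.
- by have := commute_rotate i Q03; rewrite add0n add3n.
Qed.
Lemma commutePz i : commute (P i) z.
Proof. by apply: (commuteJK (g := y)); rewrite P_y -[z ^ y]rotate0; exact: commutePW_all. Qed.
Lemma commuteQz i : commute (Q i) z.
Proof. by apply: (commuteJK (g := y)); rewrite Q_y -[z ^ y]rotate0; exact: commuteQW_all. Qed.
(** Up to a rotation, Q j is a word in z and D 2, which commute with every P i. *)
Lemma commutePQ i j : commute (P i) (Q j).
Proof.
apply: commute_sym; move: j i; apply: commute_rotates => i; rewrite cross_D.
apply: commute_sym; apply: commuteM; first exact: commutePz.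
by apply: commute_conj; [exact: commutePz|exact: commutePD].
Qed.

Lemma mem_rot u i : rt u i \in [:: rt u 0; rt u 1; rt u 2; rt u 3].
Proof.
rewrite rotate_mod; have : (i %% 4 < 4)%N by rewrite ltn_mod.
by case: (i %% 4) => [|[|[|[|//]]]] _; rewrite !inE eqxx ?orbT.
Qed.
Lemma rot_mem u v : v \in [:: rt u 0; rt u 1; rt u 2; rt u 3] -> exists i, v = rt u i.
Proof.
by rewrite !inE => /or4P [] /eqP ->; [exists 0%N|exists 1%N|exists 2%N|exists 3%N].
Qed.

Definition crosses := [:: P 0; P 1; P 2; P 3] ++ [:: Q 0; Q 1; Q 2; Q 3].
Lemma crosses_mem u : u \in crosses -> exists i, u = P i \/ u = Q i.
Proof. by rewrite mem_cat => /orP [] /rot_mem [i ->]; exists i; [left|right]. Qed.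
Lemma mem_crosses i : (P i \in crosses) * (Q i \in crosses).
Proof. by rewrite !mem_cat !mem_rot orbT. Qed.

Lemma crosses_normal g n : generated [set` crosses] n -> generated [set` crosses] (n ^ g).
Proof.
have sF := generated_subgroup [set` crosses].
have normal t : t * t = 1 -> (forall u, u \in crosses -> u ^ t \in crosses) ->
    forall n, generated [set` crosses] (n ^ t) <-> generated [set` crosses] n.
  move=> t2 tc; have sub := generated_sub (subgroupJ t sF) (_ : [set` crosses] `<=` _).
  have {}sub m : generated [set` crosses] m -> generated [set` crosses] (m ^ t).
    by apply: sub => u uc; apply: mem_generated_seq; exact: tc.
  by move=> m; split=> [/sub|/sub //]; rewrite -conjgM t2 conjg1.
have fixc t u : commute u t -> u \in crosses -> u ^ t \in crosses by move/conj_commute ->.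
have yc u : u \in crosses -> u ^ y \in crosses.
  by case/crosses_mem => i [] ->; rewrite ?P_y ?Q_y mem_crosses.
suff H h : forall m, generated [set` crosses] (m ^ h) <-> generated [set` crosses] m by move/H.
move: h; apply: (setup_gen S (normaliser_subgroup _)); apply: normal => //= u.
- move=> uc; apply: fixc => //.
  by case/crosses_mem: uc => i [] ->; [exact: commutePa|exact: commuteQa].
- move=> uc; rewrite {1}x_rot conjgM; apply: yc.
  by case/crosses_mem: uc => i [] ->; rewrite rotateS mem_crosses.
- move=> uc; apply: fixc => //.
  by case/crosses_mem: uc => i [] ->; [exact: commutePz|exact: commuteQz].
Qed.
Lemma fin2_crosses : fin2 (generated [set` crosses]).
Proof.
apply: fin2_class2 => [u|u v w] /crosses_mem [i].
  by case=> ->; [exact: involP|exact: involQ].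
move=> ui /crosses_mem [j vj] /crosses_mem [k wk]; apply/commute_sym/commuteX/commuteM.
- by case: ui wk => -> [] ->; [exact: commutePP|exact/commute_sym/commutePQ|exact: commutePQ|
    exact: commuteQQ].
- by case: vj wk => -> [] ->; [exact: commutePP|exact/commute_sym/commutePQ|exact: commutePQ|
    exact: commuteQQ].
Qed.

(** * The group when P and Q are trivial *)

Definition gensZ := [:: Z 0; Z 1; Z 2; Z 3].
Definition gensW := [:: W 0; W 1; W 2; W 3].
Definition gensK := gensZ ++ gensW.
Local Notation A := (generated [set` gensZ]).
Local Notation B := (generated [set` gensW]).
Local Notation K := (generated [set` gensK]).

Lemma commute_squareZ i j k : commute ((Z i * Z j) ^+ 2) (Z k).
Proof.
have H d : (d < 4)%N -> commute ((Z i * Z (i + d)) ^+ 2) (Z k).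
  rewrite expg2 mulgA; case: d => [|[|[|[|//]]]] _.
  - by rewrite addn0 involZ mul1g involZ; apply/commute_sym/commute1.
  - by rewrite addn1 -sigmaE; exact: commute_sigmaZ.
  - have -> : Z i * Z (i + 2) * Z i * Z (i + 2) = mu ^ (r ^+ i).
      by rewrite mu02 !(conjMg _ _ (r ^+ i)) !rotateD addnC.
    by rewrite (conj_commute (commuteX i (commuteE mu_rot))); exact: commute_muZ.
  - have -> : Z i * Z (i + 3) * Z i * Z (i + 3) = (sigma (i + 3))^-1.
      rewrite sigmaE -addnS addn4 rotate4; have ? := involZ i; have ? := involZ (i + 3).
      by coxeter.
    by apply/commute_sym/commuteV/commute_sym; exact: commute_sigmaZ.
have -> : Z j = Z (i + (j + 3 * i) %% 4).
  apply: rotate_eqmod; rewrite modnDmr addnA [(i + j)%N]addnC -addnA -mulSn.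
  by rewrite addnC mulnC modnMDl.
by apply: H; rewrite ltn_mod.
Qed.
Lemma commute_squareW i j k : commute ((W i * W j) ^+ 2) (W k).
Proof.
apply: (commuteJK (g := y)).
by rewrite conjXg (conjMg (W i)) !rotate_yy; exact: commute_squareZ.
Qed.
Lemma fin2_K : fin2 K.
Proof.
have memK u : u \in gensK -> exists i, u = Z i \/ u = W i.
  by rewrite mem_cat => /orP [] /rot_mem [i ->]; exists i; [left|right].
apply: fin2_class2 => [u|u v w] /memK [i]; first by case=> ->; [exact: involZ|exact: involW].
have ZZW l j k : commute ((Z l * Z j) ^+ 2) (W k).
  by apply/commute_sym/commuteX/commuteM; apply/commute_sym/commuteZW.
have WWZ l j k : commute ((W l * W j) ^+ 2) (Z k).
  by apply/commute_sym/commuteX/commuteM; apply/commuteZW.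
have ZW1 l j : (Z l * W j) ^+ 2 = 1.
  by have ? := commuteZW l j; have ? := involZ l; have ? := involW j; rewrite expg2; coxeter.
have WZ1 l j : (W l * Z j) ^+ 2 = 1.
  by have ? := commuteZW j l; have ? := involZ j; have ? := involW l; rewrite expg2; coxeter.
move=> iE /memK [j jE] /memK [k kE].
by case: iE => ->; case: jE => ->; case: kE => ->; rewrite ?ZW1 ?WZ1;
  first [exact: commute_squareZ|exact: commute_squareW|exact: ZZW|exact: WWZ|
         exact/commute_sym/commute1].
Qed.

(** The last quotient is by the P and Q. *)
Hypothesis cross1 : cross 1 = 1.
Hypothesis cross2 : cross 2 = 1.

(** The commutators of c with W 1 and W 2 are trivial now; W 0 and W 3 always commute
    with c. *)
Lemma commuteCW_all i j : commute (C i) (W j).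
Proof.
have H k : cross k = 1 -> commute (C 0) (W k).
  move=> ck; rewrite rotate0; have := commute_cross_W k.
  have ? := c2; have ? := involW k; rewrite crossE in ck; move=> _.
  by coxeter_by ck (1 : G) (W k * c).
move: i j; apply: commute_offsets => i; first exact: commuteCW0.
- by have := commute_rotate i (H 1%N cross1); rewrite add0n.
- by have := commute_rotate i (H 2 cross2); rewrite add0n.
- by have := commuteCW3 i; rewrite addnC.
Qed.
Lemma commuteDZ_all i j : commute (D i) (Z j).
Proof. by apply: (commuteJK (g := y)); rewrite rotate_yy rotate_y; exact: commuteCW_all. Qed.

(** The elements k that commute with v, and for which a * a ^ k does, form a subgroup:
    a * a ^ (g * h^-1) is conjugate under h to the product of (a * a ^ h)^-1 and a * a
    ^ g. *)
Lemma commute_shifts (s t : seq G) : (forall u v, u \in s -> v \in t -> commute u v) ->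
  (forall u v, u \in s -> v \in t -> commute (a * a ^ u) v) ->
  forall k l, generated [set` s] k -> generated [set` t] l ->
  commute k l /\ commute (a * a ^ k) l.
Proof.
move=> st ast k l sk; move: l.
have sS v : is_subgroup [set k | commute k v /\ commute (a * a ^ k) v].
  split=> [|g h [gv agv] [hv ahv]].
    by split; [exact/commute_sym/commute1|rewrite conjg1 a2; exact/commute_sym/commute1].
  have hVv : commute h^-1 v by apply/commute_sym/commuteV/commute_sym.
  split; first exact: commuteMl.
  have -> : a * a ^ (g / h) = ((a * a ^ h)^-1 * (a * a ^ g)) ^ h^-1.
    rewrite invgM -mulgA (mulKg a) (conjMg _ (a ^ g)) conjVg -!(conjgM a) mulgV conjg1.
    by rewrite (involV a2).
  by apply: commute_conjl => //; apply: commuteMl => //; exact/commute_sym/commuteV/commute_sym.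
have kv v : v \in t -> commute k v /\ commute (a * a ^ k) v.
  by move=> vt; apply: (generated_sub (sS v) _ sk) => u us; split; [exact: st|exact: ast].
move=> l tl; split; apply: commute_sym; apply: commute_generated tl => v vt.
- by have [] := kv v vt; move/commute_sym.
- by have [_] := kv v vt; move/commute_sym.
Qed.

Lemma commute_shiftA k l : A k -> B l -> commute k l /\ commute (a * a ^ k) l.
Proof.
apply: commute_shifts => u v /rot_mem [i ->] /rot_mem [j ->]; first exact: commuteZW.
by rewrite conj_aZ mulgA a2 mul1g; exact: commuteCW_all.
Qed.
Lemma commute_shiftB k l : A k -> B l -> commute (a * a ^ l) k.
Proof.
move=> Ak Bl; have [] // := commute_shifts _ _ Bl Ak => u v /rot_mem [i ->] /rot_mem [j ->].
  exact/commute_sym/commuteZW.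
by rewrite conj_aW mulgA a2 mul1g; exact: commuteDZ_all.
Qed.
Lemma refl_A k i : A k -> B (k ^ (y * r ^+ i)).
Proof.
apply: (generated_sub (subgroupJ _ (generated_subgroup _))) => u /rot_mem [j ->] /=.
by rewrite rotate_yr; apply: mem_generated_seq; exact: mem_rot.
Qed.
Lemma refl_B l i : B l -> A (l ^ (y * r ^+ i)).
Proof.
apply: (generated_sub (subgroupJ _ (generated_subgroup _))) => u /rot_mem [j ->] /=.
by rewrite rotate_yyr; apply: mem_generated_seq; exact: mem_rot.
Qed.

Lemma conj_a_product k l : A k -> B l -> a * a ^ (k * l) = a * a ^ l * (a * a ^ k).
Proof.
move=> Ak Bl; have [kl akl] := commute_shiftA Ak Bl.
rewrite conjgM -{1}[a ^ k](involKl a2) (conjMg a) (conj_commute akl).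
by rewrite !mulgA.
Qed.
(** Both products give a * a ^ (k * l), as k and l commute. *)
Lemma commute_shiftAB k l : A k -> B l -> commute (a * a ^ k) (a * a ^ l).
Proof.
move=> Ak Bl; have [kl akl] := commute_shiftA Ak Bl; have alk := commute_shiftB Ak Bl.
rewrite /commute -(conj_a_product Ak Bl) kl conjgM -{2}[a ^ l](involKl a2).
rewrite (conjMg a) (conj_commute alk).
by rewrite !mulgA.
Qed.

(** The sandwich condition for a and a reflection makes the squares of the
    elements a a ^ k invariant under reflections, hence central. *)
Lemma square_refl k i : A k ->
  (a * a ^ k) ^+ 2 = (a * a ^ (k ^ (y * r ^+ i))) ^+ 2.
Proof.
move=> Ak; have := commute_a_conj k i; have := commute_shiftAB Ak (refl_A i Ak).
set l := k ^ _ => H1 H2; have ? := involJ k a2; have ? := involJ l a2.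
by rewrite !expg2; coxeter_by H1 (1 : G) (a ^ l * a ^ k).
Qed.
Lemma square_shift_reflJ k i : A k ->
  ((a * a ^ k) ^+ 2) ^ (y * r ^+ i) = (a * a ^ k) ^+ 2.
Proof.
move=> Ak; set t := y * r ^+ i.
have ta : a ^ t = a by apply/conj_commute/commuteM; [exact: setup_ay S|exact: commute_a_rot].
by rewrite conjXg (conjMg a) (conjJg a) ta -(square_refl i Ak).
Qed.
Lemma square_shift_central k : A k -> forall g, commute ((a * a ^ k) ^+ 2) g.
Proof.
move=> Ak; apply: central_of.
- have [H _ _] := square_invol a2 (involJ k a2) (sw k ina ina).
  by rewrite expg2 mulgA.
- have -> : r = (y * r ^+ 0)^-1 * (y * r ^+ 1).
    by rewrite expg0 mulg1 expg1 (mulKg y).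
  apply: commuteM; first exact/commuteV/commuteE/square_shift_reflJ.
  exact/commuteE/square_shift_reflJ.
- by have := commuteE (square_shift_reflJ 0 Ak); rewrite expg0 mulg1.
- rewrite (square_refl 0 Ak); apply/commute_sym/commuteX/commute_sym/commute_shiftB.
    by rewrite -(rotate0 z); apply: mem_generated_seq; exact: mem_rot.
  exact: refl_A.
Qed.
Lemma square_shift_centralB l : B l -> forall g, commute ((a * a ^ l) ^+ 2) g.
Proof.
move=> Bl; have Al := refl_B 0 Bl; have Cl := square_shift_central Al.
have -> : (a * a ^ l) ^+ 2 = (a * a ^ (l ^ (y * r ^+ 0))) ^+ 2 => //.
rewrite (square_refl 0 Al) -conjgM expg0 mulg1 y2 conjg1 //.
Qed.

Lemma mem_K_product g : K g -> exists k l, [/\ A k, B l & g = k * l].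
Proof.
have sA := generated_subgroup [set` gensZ]; have sB := generated_subgroup [set` gensW].
have nBA : normalises B A.
  by move=> l k Bl Ak; have [kl _] := commute_shiftA Ak Bl; rewrite (conj_commute kl).
move: g; have sAB := subgroup_mulset sA sB nBA.
suff H g : K g -> [set k * l | k in A & l in B] g.
  by move=> g /H [k Ak [l Bl <-]]; exists k, l.
apply: (generated_sub sAB) => u /=; rewrite mem_cat => /orP [] uk.
- by exists u; [exact: mem_generated_seq|exists 1; [exact: sub1|rewrite mulg1]].
- by exists 1; [exact: sub1|exists u; [exact: mem_generated_seq|rewrite mul1g]].
Qed.
(** Up to conjugation the product is a * a ^ (k * l) with k in A and l in B, and its
    square is the product of the central squares of a * a ^ l and a * a ^ k. *)
Lemma square_K g h k : K g -> K h -> commute ((a ^ g * a ^ h) ^+ 2) k.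
Proof.
move=> Kg Kh; have sK := generated_subgroup [set` gensK].
suff H : forall k, commute ((a * a ^ (h * g^-1)) ^+ 2) k.
  have -> : a ^ g * a ^ h = (a * a ^ (h * g^-1)) ^ g.
    by rewrite (conjMg a) -(conjgM a) mulgVK.
  by rewrite -conjXg (conj_commute (H g)).
move=> {}k; have [k' [l [Ak Bl ->]]] := mem_K_product (subM sK Kh (subV sK Kg)).
rewrite (conj_a_product Ak Bl).
have c := commute_shiftAB Ak Bl.
have -> : (a * a ^ l * (a * a ^ k')) ^+ 2 = (a * a ^ l) ^+ 2 * (a * a ^ k') ^+ 2.
  by apply: expgMn; exact: commute_sym.
by apply: commuteMl; [exact: square_shift_centralB|exact: square_shift_central].
Qed.

Lemma sandwich_pair u v : u \in [:: a; x; y; z] -> v \in [:: a; x; y; z] -> commute u (u ^ v).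
Proof. by move=> iu iv; rewrite -[v]conjg1; exact: sw. Qed.

(** The conjugates of a under K are involutions with central commutators, so they
    generate a finite 2-group M. It is normalised by K, and M K by <x, y>. *)
Lemma fin2_no_cross : fin2 [set: G].
Proof.
have sK := generated_subgroup [set` gensK]; have fK := fin2_K.
have /finite_seqP [s sE] := fK.1.
pose M := generated [set` [seq a ^ g | g <- s]]; have sM : is_subgroup M := generated_subgroup _.
have memM g : K g -> M (a ^ g).
  by move=> Kg; apply: mem_generated_seq; apply/mapP; exists g => //; move: Kg; rewrite sE.
have inM u : u \in [seq a ^ g | g <- s] -> exists2 g, K g & u = a ^ g.
  by case/mapP => g gs ->; exists g; rewrite // sE.
have fM : fin2 M.
  apply: fin2_class2 => [u /inM [g _ ->]|u v w /inM [g Kg ->] /inM [h Kh ->] /inM [k Kk ->]].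
    exact: involJ.
  exact: square_K.
have nKM : normalises K M.
  move=> h n Kh; apply: (generated_sub (subgroupJ h sM)) => u /inM [g Kg ->] /=.
  by rewrite -conjgM; apply: memM; exact: (subM sK).
have sN := subgroup_mulset sM sK nKM; have fN := fin2_mulset sM sK nKM fM fK.
set N := [set _ | _ in _ & _ in _] in sN fN.
pose E := generated [set` [:: x; y]]; have sE' : is_subgroup E := generated_subgroup _.
have fE : fin2 E.
  apply: fin2_class2 => [u|u v w]; first by rewrite !inE => /orP [] /eqP ->.
  have [xyx xyy _] := square_invol x2 y2 (sandwich_pair inx iny).
  have [yxy yxx _] := square_invol y2 x2 (sandwich_pair iny inx).
  rewrite !inE expg2 mulgA => /orP [] /eqP -> /orP [] /eqP -> /orP [] /eqP -> //;
    rewrite ?x2 ?y2 ?mul1g ?x2 ?y2; exact/commute_sym/commute1.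
have nEN : normalises E N.
  suff H t : t \in [:: x; y] -> forall n, N n -> N (n ^ t).
    have tt t : t \in [:: x; y] -> t * t = 1 by rewrite !inE => /orP [] /eqP ->.
    have sub : E `<=` [set g | forall n, N (n ^ g) <-> N n].
      apply: (generated_sub (normaliser_subgroup N)) => t it n; split; last exact: H.
      by move/(H t it); rewrite -conjgM (tt t it) conjg1.
    by move=> e n Ee Nn; apply/(sub e Ee n).
  move=> it _ [m Mm [k Kk <-]].
  have at_ : a ^ t = a.
    move: it; rewrite !inE => /orP [] /eqP ->; apply: conj_commute; first exact: setup_ax S.
    exact: setup_ay S.
  have Kt g : K g -> K (g ^ t).
    apply: (generated_sub (subgroupJ t sK)) => u /=; rewrite mem_cat => /orP [] /rot_mem [i ->];
    move: it; rewrite !inE => /orP [] /eqP ->; rewrite ?rotate_yx ?rotate_yy ?rotate_x ?rotate_y;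
    by apply: mem_generated_seq; rewrite mem_cat !mem_rot ?orbT.
  exists (m ^ t); last by exists (k ^ t); [exact: Kt|rewrite -(conjMg m)].
  move: m Mm; apply: (generated_sub (subgroupJ t sM)) => u /inM [g Kg ->] /=.
  rewrite conjJg at_. exact: (memM _ (Kt _ Kg)).
apply: fin2_sub (fin2_mulset sN sE' nEN fN fE) => g _.
have sNE := subgroup_mulset sN sE' nEN.
have NE u : N u -> [set n * h | n in N & h in E] u.
  by move=> Nu; exists u => //; exists 1; [exact: sub1|rewrite mulg1].
have EE u : u \in [:: x; y] -> [set n * h | n in N & h in E] u.
  move=> iu; exists 1; first exact: sub1.
  by exists u; [exact: mem_generated_seq|rewrite mul1g].
apply: (setup_gen S sNE).
- apply: NE; exists (a ^ 1); first by apply: memM; exact: sub1.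
  by exists 1; [exact: sub1|rewrite mulg1 conjg1].
- by apply: EE; rewrite mem_head.
- by apply: EE; rewrite !inE eqxx orbT.
- apply: NE; exists 1; first exact: sub1.
  exists z; last by rewrite mul1g.
  by rewrite -(rotate0 z); apply: mem_generated_seq; rewrite mem_cat mem_rot.
Qed.

End Setup.

(** * Homomorphic images *)

Section Morphism.
Variables (G Q : groupType) (f : G -> Q).
Hypothesis fM : {morph f : g h / g * h}.

Lemma morph1 : f 1 = 1.
Proof. by apply: (mulgI (f 1)); rewrite -fM !mulg1. Qed.
Lemma morphV g : f g^-1 = (f g)^-1.
Proof. by apply: (mulgI (f g)); rewrite -fM !mulgV morph1. Qed.
Lemma morphJ g h : f (g ^ h) = f g ^ f h.
Proof. by rewrite /conjg !fM morphV. Qed.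
Lemma morphX g n : f (g ^+ n) = f g ^+ n.
Proof. by elim: n => [|n IH]; rewrite ?expg0 ?morph1 // !expgS fM IH. Qed.
Lemma morph_commute g h : commute g h -> commute (f g) (f h).
Proof. by move=> gh; rewrite /commute -!fM gh. Qed.
Lemma morph_rotate x y u i : f (rotate x y u i) = rotate (f x) (f y) (f u) i.
Proof. by rewrite !rotateE morphJ morphX fM. Qed.
Lemma morph_comm_za a z : f (comm_za a z) = comm_za (f a) (f z).
Proof. by rewrite !cE fM morphJ. Qed.
Lemma morph_eta x y z : f (eta_z x y z) = eta_z (f x) (f y) (f z).
Proof. by rewrite !etaE !fM !morph_rotate. Qed.
Lemma morph_zeta a x y z : f (zeta a x y z) = zeta (f a) (f x) (f y) (f z).
Proof. by rewrite !zetaE !fM !morph_rotate morph_comm_za. Qed.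
Lemma morph_cross a x y z j : f (cross a x y z j) = cross (f a) (f x) (f y) (f z) j.
Proof. by rewrite !crossE fM morphJ morph_rotate morphJ morph_comm_za. Qed.
Lemma morph_theta a x y z j : f (theta a x y z j) = theta (f a) (f x) (f y) (f z) j.
Proof. by rewrite !thetaE fM morphJ morph_cross morph_zeta. Qed.

Definition morphE := (morphJ, morph_rotate, morph_comm_za, morph_eta, morph_zeta,
  morph_cross, morph_theta, fM).

Hypothesis f_onto : forall u, exists g, f g = u.

Lemma morph_setup a x y z : sandwich_setup a x y z ->
  sandwich_setup (f a) (f x) (f y) (f z).
Proof.
move=> S; split; try by rewrite -fM ?(setup_a2 S) ?(setup_x2 S) ?(setup_y2 S) ?(setup_z2 S) morph1.
- move=> H sH Ha Hx Hy Hz u; have [g <-] := f_onto u.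
  apply: (setup_gen S (H := [set g | H (f g)])) => //; split=> /= [|h k Hh Hk].
    by rewrite morph1; exact: sub1.
  by rewrite fM morphV; exact: sH.2.
- exact/morph_commute/(setup_ax S).
- exact/morph_commute/(setup_ay S).
- by rewrite -!morphJ -fM; exact/morph_commute/(setup_cx S).
- by rewrite -!morphJ -fM; exact/morph_commute/(setup_cy S).
have lift u : u \in [:: f a; f x; f y; f z] -> exists2 g, g \in [:: a; x; y; z] & u = f g.
  by rewrite !inE => /or4P [] /eqP ->; [exists a|exists x|exists y|exists z];
    rewrite ?inE ?eqxx ?orbT.
move=> u v w /lift [u' iu ->] /lift [v' iv ->]; have [g <-] := f_onto w.
by rewrite -!morphJ; apply/morph_commute/(setup_sandwich S).
Qed.

Lemma fin2_extension N : (forall g, f g = 1 <-> N g) -> fin2 N -> fin2 [set: Q] ->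
  fin2 [set: G].
Proof.
move=> kerN [fN tN] [fQ tQ]; split.
  have [sec secK] := boolp.choice f_onto.
  have : finite_set ((fun p => p.1 * sec p.2) @` (N `*` [set: Q])).
    exact/finite_image/finite_setX.
  apply: sub_finite_set => g _; exists (g * (sec (f g))^-1, f g); last by rewrite /= mulgVK.
  by split=> //=; apply/kerN; rewrite fM morphV secK mulgV.
move=> g _; have [i gi] := tQ (f g) I; have [|j gj] := tN (g ^+ (2 ^ i)%N).
  by apply/kerN; rewrite morphX.
by exists (i + j)%N; rewrite expnD expgnA.
Qed.
End Morphism.

(** The relations pass to G / N, so that N may be assumed trivial. *)
Lemma fin2_by_quotient (G : groupType) (a x y z : G) (N : set G) :
  sandwich_setup a x y z -> is_subgroup N -> (forall g n, N n -> N (n ^ g)) -> fin2 N ->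
  (forall (Q : groupType) (f : G -> Q), {morph f : g h / g * h} ->
    sandwich_setup (f a) (f x) (f y) (f z) -> (forall g, N g -> f g = 1) ->
    fin2 [set: Q]) ->
  fin2 [set: G].
Proof.
move=> S sN nN fN H; have [Q [f [fM f_onto kerN]]] := quotient_exists sN nN.
apply: (fin2_extension fM f_onto kerN fN).
by apply: (H Q f fM (morph_setup fM f_onto S)) => g /kerN.
Qed.

Lemma fin2_by_central (G : groupType) (a x y z e : G) :
  sandwich_setup a x y z -> (forall g, commute e g) -> e * e = 1 ->
  (forall (Q : groupType) (f : G -> Q), {morph f : g h / g * h} ->
    sandwich_setup (f a) (f x) (f y) (f z) -> f e = 1 -> fin2 [set: Q]) ->
  fin2 [set: G].
Proof.
move=> S ec e2 H; apply: (fin2_by_quotient S (subgroup_involution e2)).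
- by move=> g n [] ->; [left; rewrite conj1g|right; rewrite (conj_commute (ec g))].
- exact: fin2_involution.
- by move=> Q f fM SQ ker; apply: (H Q f fM SQ); apply: ker; right.
Qed.

Local Notation nu_trivial a x y z := (rotate x y (comm_za a z) 0 * rotate x y (comm_za a z) 1
  * rotate x y (comm_za a z) 0 * rotate x y (comm_za a z) 1 = 1).
Local Notation theta12_trivial a x y z := (theta a x y z 1 * theta a x y z 2 = 1).
Local Notation theta_trivial a x y z := (theta a x y z 1 = 1).
Local Notation delta_trivial a x y z :=
  (rotate x y (cross a x y z 1) 0 * rotate x y (cross a x y z 1) 0 ^ eta_z x y z = 1).
Local Notation omega_trivial a x y z := (rotate x y (cross a x y z 1) 0
  * rotate x y (cross a x y z 1) 0 ^ rotate x y (z ^ y) 0 = 1).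

Ltac transfer f fM := move/(congr1 f); rewrite !(morphE fM) (morph1 fM).

(** The subgroup generated by the P and Q is a normal, finite abelian group. *)
Lemma fin2_omega (G : groupType) (a x y z : G) : sandwich_setup a x y z ->
  nu_trivial a x y z -> theta12_trivial a x y z -> theta_trivial a x y z ->
  delta_trivial a x y z -> omega_trivial a x y z -> fin2 [set: G].
Proof.
move=> S nu1 t12 t1 d1 o1; set F := Defs.generated [set` crosses a x y z].
have nF := crosses_normal S nu1 t12 d1 o1.
apply: (fin2_by_quotient S (generated_subgroup _) nF (fin2_crosses S nu1 t1 d1 o1)).
move=> Q f fM SQ ker.
have c1 j : F (cross a x y z j) -> cross (f a) (f x) (f y) (f z) j = 1.
  by move/ker; rewrite (morph_cross fM).
by apply: (fin2_no_cross SQ); apply: c1; apply: mem_generated_seq;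
  rewrite -(rotate0 x y (cross _ _ _ _ _)) mem_crosses.
Qed.
(** Each step from here on factors out the central involution that the next relation
    makes trivial. The earlier relations are between words in the generators and
    survive in the quotient. *)
Lemma fin2_delta (G : groupType) (a x y z : G) : sandwich_setup a x y z ->
  nu_trivial a x y z -> theta12_trivial a x y z -> theta_trivial a x y z ->
  delta_trivial a x y z -> fin2 [set: G].
Proof.
move=> S nu1 t12 t1 d1.
apply: (fin2_by_central S (omega_central S nu1 t1 d1) (omega_square S nu1 d1)).
move=> Q f fM SQ; rewrite !(morphE fM) => o1.
by apply: (fin2_omega SQ _ _ _ _ o1); [move: nu1|move: t12|move: t1|move: d1]; transfer f fM.
Qed.
Lemma fin2_theta (G : groupType) (a x y z : G) : sandwich_setup a x y z ->
  nu_trivial a x y z -> theta12_trivial a x y z -> theta_trivial a x y z -> fin2 [set: G].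
Proof.
move=> S nu1 t12 t1.
apply: (fin2_by_central S (delta_central S nu1 t12 t1) (delta_square S nu1 t12)).
move=> Q f fM SQ; rewrite !(morphE fM) => d1.
by apply: (fin2_delta SQ _ _ _ d1); [move: nu1|move: t12|move: t1]; transfer f fM.
Qed.
Lemma fin2_theta12 (G : groupType) (a x y z : G) : sandwich_setup a x y z ->
  nu_trivial a x y z -> theta12_trivial a x y z -> fin2 [set: G].
Proof.
move=> S nu1 t12.
apply: (fin2_by_central S (theta_central S nu1 t12) (theta_square S nu1)).
move=> Q f fM SQ; rewrite !(morphE fM) => t1.
by apply: (fin2_theta SQ _ _ t1); [move: nu1|move: t12]; transfer f fM.
Qed.
Lemma fin2_nu (G : groupType) (a x y z : G) : sandwich_setup a x y z ->
  nu_trivial a x y z -> fin2 [set: G].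
Proof.
move=> S nu1; apply: (fin2_by_central S (theta12_central S nu1) (theta12_square S nu1)).
move=> Q f fM SQ; rewrite !(morphE fM) => t12.
by apply: (fin2_theta12 SQ _ t12); move: nu1; transfer f fM.
Qed.
Lemma fin2_setup (G : groupType) (a x y z : G) : sandwich_setup a x y z -> fin2 [set: G].
Proof.
move=> S; apply: (fin2_by_central S (nu_central S) (nu_square S)).
by move=> Q f fM SQ; rewrite !(morphE fM) => n1; apply: fin2_nu SQ n1.
Qed.

(** * The sandwich group *)

Lemma commute_of_commutator (G : groupType) (u v : G) : [~ u, v] = 1 -> commute u v.
Proof. by move=> uv; apply: commuteE; apply: (mulgI u^-1); rewrite mulVg. Qed.

Lemma class2_commutator (G : groupType) (u v : G) :
  nilpotent_class_le 2 (generated [set u; v]) -> commute [~ u, v] u.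
Proof.
move=> nil; apply: commute_of_commutator.
have : lower_central (generated [set u; v]) 2 [~ [~ u, v], u].
  apply: mem_generated; exists [~ u, v]; last exists u => //.
    apply: mem_generated; exists u; last exists v => //; apply: mem_generated; [left|right]=> //.
  by apply: mem_generated; left.
by rewrite nil.
Qed.

Theorem theorem3p2 (G : groupType) (a x y z : G)
  (distinct_axyz : uniq [:: a; x; y; z])
  (gen_axyz : sandwich_generating_set [set a; x; y; z])
  (inv_a : involution a) (inv_x : involution x)
  (inv_y : involution y) (inv_z : involution z)
  (edges_axyz : commutativity_edges [set a; x; y; z]
                = [set [set a; x]; [set a; y]])
  (comm_zx_za : [~ [~ z, x], [~ z, a]] = 1)
  (comm_zy_za : [~ [~ z, y], [~ z, a]] = 1) :
  is_nilpotent [set: G].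
Proof.
have [sand genG] := gen_axyz.
have sq (u : G) : involution u -> u * u = 1 by case=> _; rewrite expg2.
have mem u : u \in [:: a; x; y; z] -> [set a; x; y; z] u.
  by rewrite !inE => /or4P [] /eqP ->; [left; left; left|left; left; right|left; right|right].
have sand2 u v g : u \in [:: a; x; y; z] -> v \in [:: a; x; y; z] -> commute u (u ^ (v ^ g)).
  move=> iu iv; have := class2_commutator (sand u v g (mem u iu) (mem v iv) _).
  rewrite genG => /(_ I) => H.
  apply: (commuteMK (v := u^-1)); last exact/commuteV/commute_refl.
  exact: commute_sym.
have edge u v : [set u; v] = [set a; x] \/ [set u; v] = [set a; y] -> u <> v -> commute u v.
  move=> uv nuv; have : commutativity_edges [set a; x; y; z] [set u; v].
    by rewrite edges_axyz.
  move=> [u' [v' [_ _ nuv' c e]]].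
  have : [set u'; v'] u by rewrite -e; left.
  have : [set u'; v'] v by rewrite -e; right.
  by case=> -> [] E; rewrite E // in nuv *; exact: commute_sym.
move: distinct_axyz; rewrite /= !inE !negb_or => /andP [/and3P [/eqP ax /eqP ay _] _].
have a2 := sq a inv_a; have z2 := sq z inv_z.
have [ia [ix [iy iz]]] : a \in [:: a; x; y; z] /\ x \in [:: a; x; y; z] /\
  y \in [:: a; x; y; z] /\ z \in [:: a; x; y; z] by rewrite !inE !eqxx !orbT.
have cz : commute (z * z ^ a) z.
  apply/commute_sym/commuteM; first exact: commute_refl.
  by rewrite -[a]conjg1; exact: sand2.
have czs s : [~ [~ z, s], [~ z, a]] = 1 -> commute (z * z ^ a) (z ^ s).
  rewrite /commg (involV z2) => /commute_of_commutator /commute_sym H.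
  exact: commuteMK H cz.
apply/fin2_nilpotent/(@fin2_setup _ a x y z); split=> //; try exact: sq; try exact: czs.
- move=> H sH Ha Hx Hy Hz g; suff: generated [set a; x; y; z] `<=` H by apply; rewrite genG.
  by apply: generated_sub => // u [[[]|]|] ->.
- by apply: edge => //; left.
- by apply: edge => //; right.
Qed.
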